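(* Consider a finite average-loss MDP $(\ell,P)$ satisfying the Fast Mixing assumption, with feature matrix $\Phi$, vector $\mu_0$, constant $S>0$, parameter set $\Theta$, and sampling distributions $q_1$ on $\mathcal X\times\mathcal A$ and $q_2$ on $\mathcal X$, with associated constants $C_1,C_2$ (all as in the context). Let $\epsilon\in(0,1)$. Run the stochastic subgradient method described in the context with $T=1/\epsilon^4$ rounds, constraint multiplier $H=1/\epsilon$, and constant learning rate $\eta_1=\dots=\eta_T=S/(G'\sqrt T)$, where $G'=\sqrt d+H(C_1+C_2)$, and let $\widehat\theta_T$ be its output. Define $$V_1(\theta)=\sum_{(x,a)}\bigl|[\mu_0(x,a)+\Phi_{(x,a),:}\theta]_-\bigr|,\qquad V_2(\theta)=\sum_{x'}\bigl|(P-B)_{:,x'}^\top(\mu_0+\Phi\theta)\bigr|.$$ Then for any $\delta\in(0,1)$, with probability at least $1-\delta$, $$\mu_{\widehat\theta_T}^\top\ell\le\min_{\theta\in\Theta}\Bigl(\mu_\theta^\top\ell+\frac1\epsilon\bigl(V_1(\theta)+V_2(\theta)\bigr)+O(\epsilon)\Bigr),$$ where the constants hidden in the $O(\epsilon)$ are polynomials in $S$, $d$, $C_1$, $C_2$, $\log(1/\delta)$, $V_1(\theta)$, $V_2(\theta)$, $\tau(\mu_\theta)$ and $\tau(\mu_{\widehat\theta_T})$ (in particular they do not depend otherwise on the number of states).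
   Context: MDP. $\mathcal X=\{1,\dots,X\}$ and $\mathcal A=\{1,\dots,A\}$ are finite state and action spaces; $\ell:\mathcal X\times\mathcal A\to[0,1]$ is a loss function, viewed as a vector in $\mathbb R^{XA}$; $P\in\mathbb R^{XA\times X}$ is a transition kernel, with $P_{(x,a),x'}$ the probability of moving to $x'$ from $x$ under action $a$. $B\in\{0,1\}^{XA\times X}$ is the matrix with $B_{(x,a),x'}=1$ iff $x=x'$. A policy $\pi$ assigns to each state $x$ a probability distribution $\pi(\cdot|x)$ on $\mathcal A$; $P^\pi$ is the induced $X\times X$ transition matrix. If $v_\pi$ is the stationary distribution of $P^\pi$, the stationary state-action distribution of $\pi$ is $\mu_\pi(x,a)=v_\pi(x)\pi(a|x)$. $M_{i,:}$ and $M_{:,j}$ denote rows and columns of a matrix $M$. $[v]_-=v\wedge 0$ and $[v]_+=v\vee0$ (entrywise). $\|\cdot\|$ is the Euclidean norm. Fast Mixing assumption: for any policy $\pi$ there is a constant $\tau(\pi)>0$ such that for all distributions $d,d'$ over $\mathcal X$, $\|dP^\pi-d'P^\pi\|_1\le e^{-1/\tau(\pi)}\|d-d'\|_1$. Features. $\Phi\in\mathbb R^{XA\times d}$ is a feature matrix. $\mu_0\in\mathbb R^{XA}$ is either a known stationary state-action distribution (i.e. $\mu_0\ge\mathbf 0$, $\mu_0^\top\mathbf 1=1$, $\mu_0^\top(P-B)=\mathbf 0$) or $\mu_0=\mathbf 0$ if none is known. For $S>0$, $\Theta=\{\theta\in\mathbb R^d:\theta^\top\Phi^\top\mathbf 1=1-\mu_0^\top\mathbf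 1,\ \|\theta\|\le S\}$. For $\theta\in\mathbb R^d$, the policy $\pi_\theta$ is $$\pi_\theta(a|x)=\frac{[\mu_0(x,a)+\Phi_{(x,a),:}\theta]_+}{\sum_{a'}[\mu_0(x,a')+\Phi_{(x,a'),:}\theta]_+}$$ (where the denominator vanishes, $\pi_\theta(\cdot|x)$ is any fixed distribution), $\mu_\theta$ is its stationary state-action distribution, and $\tau(\mu_\theta)$ means $\tau(\pi_\theta)$. Constants. For distributions $q_1$ on $\mathcal X\times\mathcal A$ and $q_2$ on $\mathcal X$, $$C_1=\max_{(x,a)}\frac{\|\Phi_{(x,a),:}\|}{q_1(x,a)},\qquad C_2=\max_{x}\frac{\|(P-B)_{:,x}^\top\Phi\|}{q_2(x)}.$$ Stochastic subgradient method. Set $\theta_1=0$. For $t=1,\dots,T$: sample independently $(x_t,a_t)\sim q_1$ and $x_t'\sim q_2$ (i.i.d. over rounds), compute $g_t=g_t(\theta_t)$ where $$g_t(\theta)=\ell^\top\Phi-H\frac{\Phi_{(x_t,a_t),:}}{q_1(x_t,a_t)}\mathbb I_{\{\mu_0(x_t,a_t)+\Phi_{(x_t,a_t),:}\theta<0\}}+H\frac{(P-B)_{:,x_t'}^\top\Phi}{q_2(x_t')}\,s\bigl((P-B)_{:,x_t'}^\top\Phi\theta\bigr),$$ with $s(z)=\mathbb I_{\{z>0\}}-\mathbb I_{\{z<0\}}$, and update $\theta_{t+1}=\Pi_\Theta(\theta_t-\eta_tg_t)$, where $\Pi_\Theta$ is Euclidean projection onto $\Theta$. The output is $\widehat\theta_T=\frac1T\sum_{t=1}^T\theta_t$.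 *)

(* Defs.v *)
From HB Require Import structures.
From mathcomp Require Import all_boot all_order all_algebra.
From mathcomp Require Import boolp classical_sets reals.
From mathcomp.analysis Require Import sequences exp.
From mathcomp Require mpoly.

Set Implicit Arguments.
Unset Strict Implicit.
Unset Printing Implicit Defensive.

Import Order.TTheory GRing.Theory Num.Theory.
Local Open Scope classical_set_scope.
Local Open Scope ring_scope.

Definition is_dist (R : realType) (I : finType) (p : I -> R) : Prop :=
  (forall i, 0 <= p i) /\ \sum_i p i = 1.

Definition norm1 (R : realType) (I : finType) (v : I -> R) : R :=
  \sum_i `|v i|.

Definition dotv (R : realType) (d : nat) (u v : 'rV[R]_d) : R :=
  \sum_i u ord0 i * v ord0 i.

(* The library norm on 'rV[R]_d is the sup norm, hence this definition. *)
Definition norm2 (R : realType) (d : nat) (v : 'rV[R]_d) : R :=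
  Num.sqrt (\sum_i v ord0 i ^+ 2).

(* Euclidean projection; its value is 0 if K has no point closest to y. *)
Definition proj (R : realType) (d : nat) (K : set 'rV[R]_d) (y : 'rV[R]_d) :
    'rV[R]_d :=
  xget 0 [set p | K p /\ forall z, K z -> norm2 (y - p) <= norm2 (y - z)].

Section MDP.
Context {R : realType} {X A : finType}.

(* A transition kernel P : X * A -> X -> R has entries P (x, a) x', and a
   policy pi : X -> A -> R has values pi x a = pi(a | x). *)
Definition is_kernel (P : X * A -> X -> R) : Prop := forall z, is_dist (P z).

Definition is_policy (pi : X -> A -> R) : Prop := forall x, is_dist (pi x).

Definition Bmx (z : X * A) (x' : X) : R := (z.1 == x')%:R.

Definition Ppi (P : X * A -> X -> R) (pi : X -> A -> R) (x x' : X) : R :=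
  \sum_a pi x a * P (x, a) x'.

Definition push (Q : X -> X -> R) (v : X -> R) (x' : X) : R :=
  \sum_x v x * Q x x'.

Definition fast_mixing (P : X * A -> X -> R) (tau : (X -> A -> R) -> R) :
    Prop :=
  forall pi, is_policy pi ->
    0 < tau pi /\
    forall v v' : X -> R, is_dist v -> is_dist v' ->
      norm1 (fun x => push (Ppi P pi) v x - push (Ppi P pi) v' x)
        <= expR (- (tau pi)^-1) * norm1 (fun x => v x - v' x).

Definition is_stationary (Q : X -> X -> R) (v : X -> R) : Prop :=
  is_dist v /\ forall x', push Q v x' = v x'.

(* Fast mixing makes the stationary distribution unique; the default value
   (fun=> 0) is for matrices Q that have none. *)
Definition stat_dist (Q : X -> X -> R) : X -> R :=
  xget (fun=> 0) [set v | is_stationary Q v].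

Definition mu_pol (P : X * A -> X -> R) (pi : X -> A -> R) (z : X * A) : R :=
  stat_dist (Ppi P pi) z.1 * pi z.1 z.2.

Definition mu0_ok (P : X * A -> X -> R) (mu0 : X * A -> R) : Prop :=
  (is_dist mu0 /\ forall x', \sum_z mu0 z * (P z x' - Bmx z x') = 0)
  \/ (forall z, mu0 z = 0).

Definition loss (ell mu : X * A -> R) : R := \sum_z mu z * ell z.

Context {d : nat}.

Definition Theta (Phi : X * A -> 'rV[R]_d) (mu0 : X * A -> R) (S : R) :
    set 'rV[R]_d :=
  [set theta | dotv theta (\sum_z Phi z) = 1 - \sum_z mu0 z
               /\ norm2 theta <= S].

Definition lin_mu (Phi : X * A -> 'rV[R]_d) (mu0 : X * A -> R)
    (theta : 'rV[R]_d) (z : X * A) : R :=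
  mu0 z + dotv (Phi z) theta.

(* pi0 is the fixed policy used where the denominator vanishes. *)
Definition pi_theta (Phi : X * A -> 'rV[R]_d) (mu0 : X * A -> R)
    (pi0 : X -> A -> R) (theta : 'rV[R]_d) (x : X) (a : A) : R :=
  let D := \sum_a' Num.max (lin_mu Phi mu0 theta (x, a')) 0 in
  if D == 0 then pi0 x a
  else Num.max (lin_mu Phi mu0 theta (x, a)) 0 / D.

Definition PBPhi (P : X * A -> X -> R) (Phi : X * A -> 'rV[R]_d) (x' : X) :
    'rV[R]_d :=
  \sum_z (P z x' - Bmx z x') *: Phi z.

(* The terms of both maxima are nonnegative, so 0 is a neutral base value. *)
Definition C1 (Phi : X * A -> 'rV[R]_d) (q1 : X * A -> R) : R :=
  \big[Num.max/0]_z (norm2 (Phi z) / q1 z).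

Definition C2 (P : X * A -> X -> R) (Phi : X * A -> 'rV[R]_d) (q2 : X -> R) :
    R :=
  \big[Num.max/0]_x (norm2 (PBPhi P Phi x) / q2 x).

Definition V1 (Phi : X * A -> 'rV[R]_d) (mu0 : X * A -> R)
    (theta : 'rV[R]_d) : R :=
  \sum_z `|Num.min (lin_mu Phi mu0 theta z) 0|.

Definition V2 (P : X * A -> X -> R) (Phi : X * A -> 'rV[R]_d)
    (mu0 : X * A -> R) (theta : 'rV[R]_d) : R :=
  \sum_x' `|\sum_z (P z x' - Bmx z x') * lin_mu Phi mu0 theta z|.

(* A sample is w = ((x_t, a_t), x'_t). *)
Definition subgrad (P : X * A -> X -> R) (ell : X * A -> R)
    (Phi : X * A -> 'rV[R]_d) (mu0 : X * A -> R) (q1 : X * A -> R)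
    (q2 : X -> R) (H : R) (w : (X * A) * X) (theta : 'rV[R]_d) : 'rV[R]_d :=
  let c := dotv (PBPhi P Phi w.2) theta in
  \sum_z ell z *: Phi z
  - (H / q1 w.1 * (lin_mu Phi mu0 theta w.1 < 0)%R%:R) *: Phi w.1
  + (H / q2 w.2 * ((0 < c)%R%:R - (c < 0)%R%:R)) *: PBPhi P Phi w.2.

(* The iterate reached from theta_1 = 0 after consuming the samples ws, that
   is, theta_{t+1} when ws lists the first t samples. *)
Definition iterate (P : X * A -> X -> R) (ell : X * A -> R)
    (Phi : X * A -> 'rV[R]_d) (mu0 : X * A -> R) (S : R) (q1 : X * A -> R)
    (q2 : X -> R) (H eta : R) (ws : seq ((X * A) * X)) : 'rV[R]_d :=
  foldl (fun theta w =>
           proj (Theta Phi mu0 S)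
             (theta - eta *: subgrad P ell Phi mu0 q1 q2 H w theta))
        0 ws.

Definition theta_hat (P : X * A -> X -> R) (ell : X * A -> R)
    (Phi : X * A -> 'rV[R]_d) (mu0 : X * A -> R) (S : R) (q1 : X * A -> R)
    (q2 : X -> R) (H eta : R) (T : nat) (ws : T.-tuple ((X * A) * X)) :
    'rV[R]_d :=
  T%:R^-1 *: \sum_(t < T) iterate P ell Phi mu0 S q1 q2 H eta (take t ws).

End MDP.

(* Probability of E under the law of T i.i.d. rounds, each drawing
   (x_t, a_t) from q1 and, independently, x'_t from q2. *)
Definition Pr_samples (R : realType) (X A : finType) (q1 : X * A -> R)
    (q2 : X -> R) (T : nat) (E : set (T.-tuple ((X * A) * X))) : R :=
  \sum_(ws : T.-tuple ((X * A) * X) | `[< E ws >])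
    \prod_(w <- ws) (q1 w.1 * q2 w.2).

(* Main.v *)
Require Import Defs.
From HB Require Import structures.
From mathcomp Require Import all_boot all_order all_algebra.
From mathcomp Require Import boolp classical_sets reals.
From mathcomp.analysis Require Import sequences exp.
From mathcomp Require mpoly.
From mathcomp Require Import topology normedtype derive.
From mathcomp Require Import ring lra.

Set Implicit Arguments.
Unset Strict Implicit.
Unset Printing Implicit Defensive.

Import Order.TTheory GRing.Theory Num.Theory.
Import numFieldTopology.Exports numFieldNormedType.Exports.
Import (canonicals) mpoly.
Local Open Scope classical_set_scope.
Local Open Scope ring_scope.

(* Write u = mu0 + Phi theta and V = V1 + V2.  Projected subgradient descent
   minimises the convex penalised cost c(theta) = ell.u + V / eps, and with
   T = eps^-4 its excess is O(eps) uniformly over Theta with high probability: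
   the gradient noise is controlled by exponential moments of finitely many
   martingales, tested against the current iterate and against the signed basis
   vectors.  By fast mixing, the stationary distribution of pi_theta is within
   O((1 + tau) V) of u in the l1 norm: the state marginal of [u]_+ is almost
   fixed by the contraction P^pi_theta.  If V(theta) >= eps the bound is
   trivial, as losses are at most 1; otherwise c(theta_hat) <= c(theta) + O(eps)
   forces V(theta_hat) = O(eps), and both linear costs may be replaced by the
   true losses up to O(eps). *)

(** * Euclidean geometry of row vectors and projection onto closed bounded convex sets *)

Section Euclidean.
Context {R : realType} {d : nat}.
Implicit Types (u v w y z : 'rV[R]_d) (a b : R).

Lemma dotvC u v : dotv u v = dotv v u.
Proof. by apply: eq_bigr => i _; rewrite mulrC. Qed.

Lemma dotvDl u v w : dotv (u + v) w = dotv u w + dotv v w.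
Proof. by rewrite -big_split; apply: eq_bigr => i _; rewrite mxE mulrDl. Qed.

Lemma dotvZl a u w : dotv (a *: u) w = a * dotv u w.
Proof. by rewrite /dotv mulr_sumr; apply: eq_bigr => i _; rewrite mxE mulrA.
  Qed.

Lemma dotvNl u w : dotv (- u) w = - dotv u w.
Proof. by rewrite -scaleN1r dotvZl mulN1r. Qed.

Lemma dotvBl u v w : dotv (u - v) w = dotv u w - dotv v w.
Proof. by rewrite dotvDl dotvNl. Qed.

Lemma dotv0l w : dotv 0 w = 0.
Proof. by rewrite -(scale0r 0) dotvZl mul0r. Qed.

Lemma dotvDr u v w : dotv w (u + v) = dotv w u + dotv w v.
Proof. by rewrite dotvC dotvDl !(dotvC w). Qed.

Lemma dotvZr a u w : dotv w (a *: u) = a * dotv w u.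
Proof. by rewrite dotvC dotvZl (dotvC w). Qed.

Lemma dotvNr u w : dotv w (- u) = - dotv w u.
Proof. by rewrite dotvC dotvNl (dotvC w). Qed.

Lemma dotvBr u v w : dotv w (u - v) = dotv w u - dotv w v.
Proof. by rewrite dotvDr dotvNr. Qed.

Lemma dotv_suml (I : Type) (r : seq I) (Q : pred I) (F : I -> 'rV[R]_d) w :
  dotv (\sum_(i <- r | Q i) F i) w = \sum_(i <- r | Q i) dotv (F i) w.
Proof.
by apply: (big_morph (fun u => dotv u w)) => [u v|]; rewrite ?dotvDl ?dotv0l.
Qed.

Lemma dotv_sumr (I : Type) (r : seq I) (Q : pred I) (F : I -> 'rV[R]_d) w :
  dotv w (\sum_(i <- r | Q i) F i) = \sum_(i <- r | Q i) dotv w (F i).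
Proof. by rewrite dotvC dotv_suml; apply: eq_bigr => i _; rewrite dotvC. Qed.

Lemma dotv_ge0 u : 0 <= dotv u u.
Proof. by apply: sumr_ge0 => i _; rewrite -expr2 sqr_ge0. Qed.

Lemma norm2_ge0 u : 0 <= norm2 u.
Proof. exact: sqrtr_ge0. Qed.

Lemma norm2_sqr u : norm2 u ^+ 2 = dotv u u.
Proof.
have e : \sum_i u ord0 i ^+ 2 = dotv u u by apply: eq_bigr => i _; rewrite
  expr2.
by rewrite /norm2 e sqr_sqrtr// dotv_ge0.
Qed.

Lemma norm2_le u b : 0 <= b -> (norm2 u <= b) = (dotv u u <= b ^+ 2).
Proof.
by move=> b0; rewrite -norm2_sqr ler_pXn2r// ?nnegrE ?norm2_ge0.
Qed.

Lemma norm2_mono u v : (norm2 u <= norm2 v) = (dotv u u <= dotv v v).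
Proof. by rewrite norm2_le ?norm2_ge0// norm2_sqr. Qed.

Lemma cauchy_schwarz u v : `|dotv u v| <= norm2 u * norm2 v.
Proof.
rewrite -(@ler_pXn2r _ 2) ?nnegrE ?mulr_ge0 ?norm2_ge0//.
rewrite real_normK ?num_real// exprMn !norm2_sqr.
set a := dotv u u; set b := dotv u v; set c := dotv v v.
have c0 : 0 <= c := dotv_ge0 v.
(* The squared norm of [u - t *: v] as a quadratic in [t]; its minimiser [b / c] gives the claim
   when [c > 0]. *)
have key t : 0 <= a - 2 * t * b + t ^+ 2 * c.
  have := dotv_ge0 (u - t *: v).
  rewrite dotvBl !dotvBr !dotvZl !dotvZr (dotvC v u) -/a -/b -/c.
  by congr (0 <= _); ring.
move: c0; rewrite le_eqVlt => /orP[/eqP c0|c0]; last first.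
  have := key (b / c); rewrite -(pmulr_rge0 _ c0).
  have -> : c * (a - 2 * (b / c) * b + (b / c) ^+ 2 * c) = a * c - b ^+ 2.
    by field; rewrite gt_eqF.
  by rewrite subr_ge0.
have a0 : 0 <= a := dotv_ge0 u.
rewrite -c0 mulr0; have [->|b0] := eqVneq b 0; first by rewrite expr0n.
(* With [c = 0] the quadratic is affine, and this [t] gives it the negative value [- a - 2]. *)
have := key ((a + 1) / b); rewrite -c0 mulr0 addr0.
have -> : 2 * ((a + 1) / b) * b = 2 * (a + 1) by field.
lra.
Qed.

Lemma norm2D u v : norm2 (u + v) <= norm2 u + norm2 v.
Proof.
rewrite norm2_le ?addr_ge0 ?norm2_ge0// dotvDl !dotvDr (dotvC v u).
have := le_trans (ler_norm _) (cauchy_schwarz u v).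
rewrite sqrrD !norm2_sqr; lra.
Qed.

Lemma norm20 : norm2 (0 : 'rV[R]_d) = 0.
Proof.
by apply/le_anti; rewrite norm2_ge0 andbT norm2_le// dotv0l expr0n.
Qed.

Lemma norm2Z a u : norm2 (a *: u) = `|a| * norm2 u.
Proof.
apply/(@pexpIrn _ 2); rewrite ?nnegrE ?mulr_ge0 ?norm2_ge0//.
by rewrite exprMn !norm2_sqr dotvZl dotvZr real_normK ?num_real// expr2 mulrA.
Qed.

Lemma coord_le_norm2 u i : `|u ord0 i| <= norm2 u.
Proof.
rewrite -(@ler_pXn2r _ 2) ?nnegrE ?norm2_ge0// real_normK ?num_real//.
rewrite norm2_sqr /dotv (bigD1 i)//= -expr2 lerDl.
by apply: sumr_ge0 => j _; rewrite -expr2 sqr_ge0.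
Qed.

Lemma dotv_delta u i : dotv u (delta_mx ord0 i) = u ord0 i.
Proof.
rewrite /dotv (bigD1 i)//= mxE !eqxx mulr1 big1 ?addr0// => j ji.
by rewrite mxE (negbTE ji) mulr0.
Qed.

Lemma norm2_delta i : norm2 (delta_mx ord0 i : 'rV[R]_d) = 1.
Proof.
apply/(@pexpIrn _ 2); rewrite ?nnegrE ?norm2_ge0//.
by rewrite norm2_sqr dotv_delta mxE !eqxx expr1n.
Qed.

Lemma continuous_sum (T : topologicalType) (I : Type) (r : seq I)
    (f : I -> T -> R) :
  (forall i, continuous (f i)) -> continuous (fun x => \sum_(i <- r) f i x).
Proof.
move=> cf; elim: r => [|i r ih] x.
  by under eq_fun do rewrite big_nil; exact: cvg_cst.
by under eq_fun do rewrite big_cons; apply: cvgD; [exact: cf | exact: ih].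
Qed.

Lemma continuous_dotv (f g : 'rV[R]_d -> 'rV[R]_d) :
  (forall i, continuous (fun z => f z ord0 i)) ->
  (forall i, continuous (fun z => g z ord0 i)) ->
  continuous (fun z => dotv (f z) (g z)).
Proof.
by move=> cf cg; apply: continuous_sum => i x; exact: (cvgM (cf i x) (cg i x)).
Qed.

Lemma closest_point_exists (K : set 'rV[R]_d) y :
  K !=set0 -> closed K -> (exists b, forall z, K z -> norm2 z <= b) ->
  exists2 p, K p & forall z, K z -> norm2 (y - p) <= norm2 (y - z).
Proof.
move=> K0 clK [b Kb].
have cK : compact K.
  (* Compactness is stated for the sup norm, which [norm2] dominates coordinatewise. *)
  apply: bounded_closed_compact => //; exists b; split; first exact: num_real.
  move=> M bM z Kz; change (mx_norm z <= M); rewrite mx_normrE.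
  have M0 : 0 <= M by rewrite (le_trans _ (ltW bM))// (le_trans _ (Kb z Kz))//
    norm2_ge0.
  apply: bigmax_le => // -[i j] _ /=.
  by rewrite (ord1 i) (le_trans (coord_le_norm2 _ _))// (le_trans (Kb _ Kz))//
    ltW.
have cf : continuous (fun z => dotv (y - z) (y - z)).
  have c i : continuous (fun z => (y - z) ord0 i).
    move=> z; have -> : (fun z => (y - z) ord0 i) = (fun z : 'rV[R]_d => y ord0
      i - z ord0 i).
      by apply/funext => w; rewrite !mxE.
    exact: (cvgB (cvg_cst _) (@coord_continuous _ _ _ ord0 i z)).
  exact: continuous_dotv.
have [p Kp minp] := EVT_min_rV K0 cK (continuous_subspaceT cf).
exists p; first by rewrite inE in Kp.
by move=> z Kz; rewrite norm2_mono minp// inE.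
Qed.

(** Were the inner product positive, a short move from the projection [p] towards [z] would stay in
    [K] and come closer to [y]. *)
Lemma proj_in_and_obtuse (K : set 'rV[R]_d) y :
  K !=set0 -> closed K -> (exists b, forall z, K z -> norm2 z <= b) ->
  (forall u v t, K u -> K v -> 0 <= t <= 1 -> K (u + t *: (v - u))) ->
  K (proj K y) /\ forall z, K z -> dotv (y - proj K y) (z - proj K y) <= 0.
Proof.
move=> K0 clK bK cvxK.
have [p Kp minp] := closest_point_exists y K0 clK bK.
have [{}Kp {}minp] : K (proj K y) /\
    forall z, K z -> norm2 (y - proj K y) <= norm2 (y - z).
  (* A closest point exists, so [xget] does not fall back on its default 0. *)
  by rewrite /proj; case: xgetP => [_ -> []//|/(_ p)[]].
split=> // z Kz; move: (proj K y) Kp minp => {}p Kp minp.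
rewrite leNgt; apply/negP; set b := dotv _ _ => b0.
set c := dotv (z - p) (z - p).
have c0 : 0 <= c := dotv_ge0 _.
have key t : 0 <= t <= 1 -> 2 * t * b <= t ^+ 2 * c.
  move=> t01; have := minp _ (cvxK _ _ _ Kp Kz t01); rewrite norm2_mono.
  rewrite opprD addrA; move: @b @c b0 c0; move: (y - p) (z - p) => q r b c b0
    c0.
  by rewrite [in leRHS]dotvBl !dotvBr !dotvZl !dotvZr (dotvC r) -/b -/c; lra.
have bc0 : 0 < b + c by lra.
(* The step length [b / (b + c)] lies in [0, 1] even when [c = 0]; in [key] it would give
   [2 * (b + c) <= c]. *)
have t01 : 0 <= b / (b + c) <= 1.
  by rewrite divr_ge0 ?(ltW b0) ?(ltW bc0)//= ler_pdivrMr// mul1r lerDl.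
have := key _ t01.
have -> : 2 * (b / (b + c)) * b = b ^+ 2 / (b + c) ^+ 2 * (2 * (b + c)).
  by field; rewrite gt_eqF.
rewrite expr_div_n ler_pM2l ?divr_gt0 ?exprn_gt0//; lra.
Qed.

(** With [p] the projection, |y - z|^2 = |y - p|^2 + |p - z|^2 - 2 <y - p, z - p>, and the last
    inner product is nonpositive. *)
Lemma proj_nonexpansive (K : set 'rV[R]_d) y z :
  K z -> closed K -> (exists b, forall z, K z -> norm2 z <= b) ->
  (forall u v t, K u -> K v -> 0 <= t <= 1 -> K (u + t *: (v - u))) ->
  dotv (proj K y - z) (proj K y - z) <= dotv (y - z) (y - z).
Proof.
move=> Kz clK bK cvxK.
have K0 : K !=set0 by exists z.
have [Kp /(_ _ Kz) h] := proj_in_and_obtuse y K0 clK bK cvxK.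
move: (proj K y) h => {Kp} p; have := dotv_ge0 (y - p).
rewrite !dotvBl !dotvBr (dotvC p y) (dotvC z y) (dotvC p z); lra.
Qed.

End Euclidean.

(** * Stationary distributions, mixing, and the policy read off from a linear parameter *)

Section Stationary.
Context {R : realType} {X A : finType}.
Implicit Types (P : X * A -> X -> R) (pi : X -> A -> R) (Q : X -> X -> R).

Lemma norm1_triangle (I : finType) (f g h : I -> R) :
  norm1 (fun i => f i - h i) <=
  norm1 (fun i => f i - g i) + norm1 (fun i => g i - h i).
Proof. by rewrite -big_split; apply: ler_sum => i _; exact: ler_distD. Qed.

Lemma sum_pair_dep (F : X * A -> R) : \sum_z F z = \sum_x \sum_a F (x, a).
Proof. by rewrite pair_bigA; apply: eq_bigr => -[]. Qed.

Lemma Ppi_stochastic P pi : is_kernel P -> is_policy pi ->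
  forall x, is_dist (Ppi P pi x).
Proof.
move=> kP ppi x; split=> [x'|].
  by apply: sumr_ge0 => a _; rewrite mulr_ge0 ?(ppi x).1 ?(kP (x, a)).1.
rewrite exchange_big/= -[RHS](ppi x).2; apply: eq_bigr => a _.
by rewrite -mulr_sumr (kP (x, a)).2 mulr1.
Qed.

Lemma sum_push Q v : (forall x, is_dist (Q x)) ->
  \sum_x' push Q v x' = \sum_x v x.
Proof.
move=> sQ; rewrite exchange_big/=; apply: eq_bigr => x _.
by rewrite -mulr_sumr (sQ x).2 mulr1.
Qed.

(* A nonzero left fixed vector u exists because Q fixes the constants on the
   right; then |u| Q >= |u| with equal total masses, so |u| is fixed as well. *)
Lemma stationary_exists Q (x0 : X) : (forall x, is_dist (Q x)) ->
  exists v, is_stationary Q v.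
Proof.
move=> sQ.
pose M : 'M[R]_#|X| := \matrix_(i, j) Q (enum_val i) (enum_val j).
have sum_enum (F : X -> R) : \sum_(i < #|X|) F (enum_val i) = \sum_x F x.
  rewrite (reindex (@enum_rank X)) /=; last first.
    by exists enum_val => i _; rewrite ?enum_rankK ?enum_valK.
  by apply: eq_bigr => x _; rewrite enum_rankK.
(* [M - 1] kills the constant column, hence is singular and has a nonzero left kernel vector. *)
have /rowV0Pn[u /sub_kermxP uM u0] : kermx (M - 1%:M) != 0.
  rewrite kermx_eq0 row_free_unit; apply/negP => Mu.
  have M1 : (M - 1%:M) *m const_mx 1 = 0 :> 'cV[R]_#|X|.
    rewrite mulmxBl mul1mx; apply/matrixP => i j; rewrite !mxE.
    under eq_bigr do rewrite !mxE mulr1.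
    by rewrite (sum_enum (Q (enum_val i))) (sQ _).2 subrr.
  have := mulKmx Mu (const_mx 1 : 'cV[R]_#|X|); rewrite M1 mulmx0.
  move=> /matrixP/(_ (enum_rank x0) ord0); rewrite !mxE => /esym/eqP.
  by rewrite oner_eq0.
pose w x := `|u ord0 (enum_rank x)|.
have w_ge0 x : 0 <= w x := normr_ge0 _.
have uQ x' : \sum_x u ord0 (enum_rank x) * Q x x' = u ord0 (enum_rank x').
  move: uM; rewrite mulmxBr mulmx1 => /subr0_eq/matrixP/(_ ord0 (enum_rank x')).
  rewrite mxE => <-; rewrite -sum_enum; apply: eq_bigr => i _.
  by rewrite enum_valK mxE enum_rankK.
have wQ x' : w x' <= push Q w x'.
  rewrite /w -uQ (le_trans (ler_norm_sum _ _ _))//; apply: ler_sum => x _.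
  by rewrite normrM (ger0_norm ((sQ x).1 x')).
have wfix x' : push Q w x' = w x'.
  apply/eqP; rewrite -subr_eq0.
  have : \sum_x' (push Q w x' - w x') == 0 by rewrite sumrB sum_push// subrr.
  rewrite psumr_eq0 => [|x _]; last by rewrite subr_ge0.
  by move=> /allP/(_ x' (mem_index_enum _)).
pose s := \sum_x w x.
have s_neq0 : s != 0.
  apply/eqP => /eqP; rewrite /s psumr_eq0// => /allP h.
  case/eqP: u0; apply/rowP => i; rewrite mxE; apply/eqP.
  by have := h (enum_val i) (mem_index_enum _); rewrite /= /w enum_valK
    normr_eq0.
exists (fun x => w x / s); split; first split.
- by move=> x; rewrite divr_ge0 ?sumr_ge0.
- by rewrite -mulr_suml divff.
- move=> x'; rewrite /push -wfix /push mulr_suml.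
  by apply: eq_bigr => x _; rewrite mulrAC.
Qed.

Lemma stat_distP P pi (x0 : X) : is_kernel P -> is_policy pi ->
  is_stationary (Ppi P pi) (stat_dist (Ppi P pi)).
Proof.
move=> kP ppi; have [v sv] := stationary_exists x0 (Ppi_stochastic kP ppi).
by rewrite /stat_dist; case: xgetP => [_ ->//|/(_ v)].
Qed.

(** Inverting 1 + 1/t <= exp(1/t). The contraction factor thus stays at least 1/(1+t) below 1. *)
Lemma expR_Ninv_le (t : R) : 0 < t -> expR (- t^-1) <= t / (1 + t).
Proof.
move=> t0; have t10 : 0 < 1 + t by lra.
have -> : t / (1 + t) = (1 + t^-1)^-1.
  by rewrite -invf_div mulrDl mul1r divff ?gt_eqF// addrC.
rewrite expRN lef_pV2 ?posrE ?expR_gt0 ?addr_gt0 ?invr_gt0//.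
exact: expR_ge1Dx.
Qed.

(** One step of the chain moves [v] by [E] and contracts its distance [D] to stationarity, so
    [D <= E + exp(-1/tau) * D]; solving for [D] gives the factor [1 + tau]. *)
Lemma dist_to_stationary P tau pi v : is_kernel P -> fast_mixing P tau ->
  is_policy pi -> is_dist v ->
  norm1 (fun x => v x - stat_dist (Ppi P pi) x) <=
  (1 + tau pi) * norm1 (fun x => push (Ppi P pi) v x - v x).
Proof.
move=> kP fm ppi dv; have [t0 mix] := fm pi ppi.
have [x0 _|X0] := pickP (@predT X); last first.
  have := dv.2; rewrite big1; last by move=> x; have := X0 x.
  by move=> /esym/eqP; rewrite oner_eq0.
have [sd sfix] := stat_distP x0 kP ppi.
set st := stat_dist _ in sd sfix *; set D := norm1 _; set E := norm1 _.
have D0 : 0 <= D by apply: sumr_ge0.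
have h1 : D <= E + expR (- (tau pi)^-1) * D.
  apply: (le_trans (norm1_triangle _ (push (Ppi P pi) v) _)); apply: lerD.
    by apply: ler_sum => x _; rewrite distrC.
  apply: le_trans (mix v st dv sd); apply: ler_sum => x _.
  by rewrite sfix.
have h2 : D <= E + tau pi / (1 + tau pi) * D.
  by apply: le_trans h1 _; rewrite lerD2l ler_wpM2r// expR_Ninv_le.
have t10 : 0 < 1 + tau pi by lra.
move: h2; rewrite -lerBlDr.
have -> : D - tau pi / (1 + tau pi) * D = D / (1 + tau pi).
  by field; rewrite gt_eqF.
by rewrite ler_pdivrMr// mulrC.
Qed.

Lemma mu_pol_dist P pi (x0 : X) : is_kernel P -> is_policy pi ->
  is_dist (mu_pol P pi).
Proof.
move=> kP ppi; have [sd _] := stat_distP x0 kP ppi; split=> [z|].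
  by rewrite mulr_ge0 ?sd.1 ?(ppi z.1).1.
rewrite sum_pair_dep -[RHS]sd.2; apply: eq_bigr => x _.
by rewrite /mu_pol/= -mulr_sumr (ppi x).2 mulr1.
Qed.

(** Each row of [P - B] is a difference of two distributions, hence has l1 norm at most 2. *)
Lemma norm1_kernel_diff P (f : X * A -> R) : is_kernel P ->
  norm1 (fun x' => \sum_z f z * (P z x' - Bmx z x')) <= 2 * norm1 f.
Proof.
move=> kP.
apply: (@le_trans _ _ (\sum_x' \sum_z `|f z| * (P z x' + Bmx z x'))).
  apply: ler_sum => x' _; apply: (le_trans (ler_norm_sum _ _ _)).
  apply: ler_sum => z _; rewrite normrM ler_wpM2l// (le_trans (ler_normB _
    _))//.
  by rewrite !ger0_norm// ?(kP z).1// /Bmx.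
rewrite exchange_big mulr_sumr; apply: ler_sum => z _ /=.
rewrite -mulr_sumr big_split/= (kP z).2 /Bmx (bigD1 z.1)//= eqxx big1 => [|x].
  by rewrite addr0 mulrC.
by rewrite eq_sym => /negbTE ->.
Qed.

Lemma loss_le_norm1 (ell f g : X * A -> R) : (forall z, 0 <= ell z <= 1) ->
  loss ell f - loss ell g <= norm1 (fun z => f z - g z).
Proof.
move=> l01; rewrite -sumrB; apply: ler_sum => z _; rewrite -mulrBl.
have /andP[l0 l1] := l01 z; apply: (le_trans (ler_norm _)).
by rewrite normrM (ger0_norm l0) ler_piMr.
Qed.

Lemma loss_dist_bounds (ell f : X * A -> R) : (forall z, 0 <= ell z <= 1) ->
  is_dist f -> 0 <= loss ell f <= 1.
Proof.
move=> l01 [f0 f1]; apply/andP; split.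
  by apply: sumr_ge0 => z _; rewrite mulr_ge0//; case/andP: (l01 z).
rewrite -f1; apply: ler_sum => z _; rewrite ler_piMr//.
by case/andP: (l01 z).
Qed.

Context {d : nat}.
Variables (Phi : X * A -> 'rV[R]_d) (mu0 : X * A -> R) (pi0 : X -> A -> R).
Hypothesis ppi0 : is_policy pi0.
Implicit Type theta : 'rV[R]_d.

Lemma pi_theta_policy theta : is_policy (pi_theta Phi mu0 pi0 theta).
Proof.
move=> x; rewrite /pi_theta.
have [_|D0] := eqVneq (\sum_a' Num.max (lin_mu Phi mu0 theta (x, a')) 0) 0.
  exact: ppi0.
split=> [a|]; last by rewrite -mulr_suml divff.
have m0 b : 0 <= Num.max (lin_mu Phi mu0 theta (x, b)) 0.
  by rewrite le_max lexx orbT.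
by rewrite divr_ge0 ?sumr_ge0.
Qed.

(* The comparison point is h = [u]_+ / m with m the mass of [u]_+: its
   state marginal v satisfies h(x,a) = v(x) pi_theta(a|x). *)
Lemma mu_theta_close P tau theta r : is_kernel P -> fast_mixing P tau ->
  `|\sum_z lin_mu Phi mu0 theta z - 1| <= r -> r < 1 ->
  norm1 (fun z => mu_pol P (pi_theta Phi mu0 pi0 theta) z
                  - lin_mu Phi mu0 theta z) <=
  (1 + tau (pi_theta Phi mu0 pi0 theta)) *
    (6 * (V1 Phi mu0 theta + V2 P Phi mu0 theta) + 3 * r).
Proof.
move=> kP fm hr r1.
set u := lin_mu Phi mu0 theta in hr *; set pi := pi_theta Phi mu0 pi0 theta.
have ppi : is_policy pi := pi_theta_policy theta.
set v1 := V1 _ _ _; set v2 := V2 _ _ _ _.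
have v1_ge0 : 0 <= v1 by apply: sumr_ge0.
have v2_ge0 : 0 <= v2 by apply: sumr_ge0.
pose up z := Num.max (u z) 0.
have up_ge0 z : 0 <= up z by rewrite /up le_max lexx orbT.
have upE z : up z = u z + `|Num.min (u z) 0|.
  rewrite /up; case: (leP (u z) 0) => h; last by rewrite normr0 addr0.
  by rewrite ler0_norm// subrr.
pose m := \sum_z up z.
have mE : m = \sum_z u z + v1.
  by rewrite /m /v1 /V1 -big_split; apply: eq_bigr => z _; rewrite upE.
have m_gt0 : 0 < m.
  by move: hr; rewrite ler_norml => /andP[]; rewrite mE; lra.
have m_neq0 : m != 0 by rewrite gt_eqF.
have m1 : `|m - 1| <= r + v1.
  rewrite mE addrAC (le_trans (ler_normD _ _))// lerD// ger0_norm//.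
pose h z := up z / m.
have h_ge0 z : 0 <= h z by rewrite divr_ge0// ltW.
(* Normalising [up] costs [|m - 1|], and truncating [u] costs [v1]. *)
have hu : norm1 (fun z => h z - u z) <= 2 * v1 + r.
  apply: (le_trans (norm1_triangle h up u)).
  have -> : norm1 (fun z => h z - up z) = `|m - 1|.
    transitivity (\sum_z up z * `|m^-1 - 1|).
      by apply: eq_bigr => z _; rewrite /h -{2}(mulr1 (up z)) -mulrBr normrM
        ger0_norm.
    rewrite -mulr_suml -/m -{1}(ger0_norm (ltW m_gt0)) -normrM mulrBr divff//.
    by rewrite mulr1 distrC.
  have -> : norm1 (fun z => up z - u z) = v1.
    by apply: eq_bigr => z _; rewrite upE addrAC subrr add0r normr_id.
  lra.
pose v x := \sum_a h (x, a).
have hv x a : h (x, a) = v x * pi x a.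
  have vE : v x = (\sum_a up (x, a)) / m by rewrite /v mulr_suml.
  (* Where the denominator vanishes, every [up (x, a)] is 0, and both sides are 0. *)
  rewrite /pi /pi_theta -/u; case: ifPn => [/eqP D0|D0].
    rewrite vE D0 mul0r mul0r /h; move/eqP: D0.
    rewrite psumr_eq0 => [/allP/(_ a (mem_index_enum _))/eqP|b _].
      by rewrite /up => ->; rewrite mul0r.
    exact: up_ge0.
  by rewrite vE /h -/(up (x, a)) [RHS]mulrC mulrA divfK.
have dv : is_dist v.
  split=> [x|]; first exact: sumr_ge0.
  by rewrite -sum_pair_dep -mulr_suml divff.
(* Since [h] factors through [pi], the defect of [v] under P^pi is the flow defect of [h]. Below it
   splits into that of [u], giving [v2], and that of [h - u]. *)
have e x' : push (Ppi P pi) v x' - v x' = \sum_z h z * (P z x' - Bmx z x').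
  under [RHS]eq_bigr do rewrite mulrBr.
  rewrite sumrB; congr (_ - _).
    rewrite sum_pair_dep; apply: eq_bigr => x _; rewrite mulr_sumr.
    by apply: eq_bigr => a _; rewrite hv mulrA.
  rewrite sum_pair_dep (bigD1 x')//= [X in _ + X]big1 => [|x xx'].
    by rewrite addr0; apply: eq_bigr => a _; rewrite /Bmx eqxx mulr1.
  by rewrite big1// => a _; rewrite /Bmx /= (negbTE xx') mulr0.
have hpush : norm1 (fun x' => push (Ppi P pi) v x' - v x') <= v2 + 2 * (2 * v1
  + r).
  apply: (@le_trans _ _ (v2 + 2 * norm1 (fun z => h z - u z))); last first.
    by rewrite lerD2l ler_wpM2l.
  apply: le_trans (lerD (lexx v2) (norm1_kernel_diff (fun z => h z - u z) kP)).
  rewrite /v2 /V2 -big_split; apply: ler_sum => x' _ /=.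
  rewrite e; apply: le_trans (ler_normD _ _); rewrite le_eqVlt; apply/orP;
    left; apply/eqP.
  congr `|_|; rewrite -big_split; apply: eq_bigr => z _ /=.
  by rewrite -/u; ring.
have hst := dist_to_stationary kP fm ppi dv.
set st := stat_dist (Ppi P pi) in hst.
(* Both measures share the conditional law [pi], so only their state marginals differ. *)
have mh : norm1 (fun z => mu_pol P pi z - h z) <= norm1 (fun x => v x - st x).
  rewrite le_eqVlt; apply/orP; left; apply/eqP; rewrite /norm1 sum_pair_dep;
    apply: eq_bigr => x _.
  rewrite -[RHS]mulr1 -(ppi x).2 mulr_sumr; apply: eq_bigr => a _.
  by rewrite hv /mu_pol /= -/st -mulrBl normrM distrC (ger0_norm ((ppi x).1 a)).
apply: (le_trans (norm1_triangle _ h _)).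
have t0 := (fm pi ppi).1.
have h1 : norm1 (fun x => v x - st x) <= (1 + tau pi) * (v2 + 2 * (2 * v1 + r)).
  by apply: (le_trans hst); rewrite ler_wpM2l// addr_ge0// ltW.
have r0 : 0 <= r by apply: le_trans hr.
have h2 : 0 <= tau pi * (2 * v1 + r) by rewrite mulr_ge0 ?(ltW t0)//; lra.
have h3 : 0 <= tau pi * v2 by rewrite mulr_ge0 ?(ltW t0).
have h4 : 0 <= tau pi * v1 by rewrite mulr_ge0 ?(ltW t0).
have -> : (1 + tau pi) * (6 * (v1 + v2) + 3 * r) =
  (1 + tau pi) * (v2 + 2 * (2 * v1 + r)) + (2 * v1 + r) + 5 * v2
  + (tau pi * (2 * v1 + r)) + 5 * (tau pi * v2) by ring.
lra.
Qed.

End Stationary.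

(** * Sums along the trajectory of a state driven by samples *)

Section PathSums.
Context {St W : Type}.
Variable step : St -> W -> St.

(** Each term sees the state before the current sample is consumed, which is what makes centred
    terms martingale differences. *)
Fixpoint path_sum (V : zmodType) (f : St -> W -> V) (s : St) (ws : seq W) : V :=
  if ws is w :: ws' then f s w + path_sum f (step s w) ws' else 0.

Lemma path_sumE (V : zmodType) (F : St -> V) s ws :
  path_sum (fun s _ => F s) s ws =
  \sum_(t < size ws) F (foldl step s (take t ws)).
Proof.
elim: ws s => [|w ws ih] s; first by rewrite big_ord0.
by rewrite /= big_ord_recl /= ih.
Qed.

Lemma path_sumD (V : zmodType) (f g : St -> W -> V) s ws :
  path_sum (fun s w => f s w + g s w) s ws = path_sum f s ws + path_sum g s ws.
Proof.
by elim: ws s => [|w ws ih] s /=; rewrite ?addr0// ih addrACA.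
Qed.

Lemma path_sum_morph (V V' : zmodType) (h : V -> V') (f : St -> W -> V) s ws :
  h 0 = 0 -> {morph h : x y / x + y} ->
  h (path_sum f s ws) = path_sum (fun s w => h (f s w)) s ws.
Proof.
by move=> h0 hD; elim: ws s => [|w ws ih] s //=; rewrite hD ih.
Qed.

Lemma path_sum_sum (V : zmodType) (I : finType) (F : I -> St -> W -> V) s ws :
  path_sum (fun s w => \sum_i F i s w) s ws = \sum_i path_sum (F i) s ws.
Proof.
elim: ws s => [|w ws ih] s /=; first by rewrite big1.
by rewrite ih -big_split.
Qed.

Lemma eq_path_sum (V : zmodType) (f g : St -> W -> V) s ws :
  (forall s w, f s w = g s w) -> path_sum f s ws = path_sum g s ws.
Proof. by move=> fg; elim: ws s => [|w ws ih] s //=; rewrite fg ih. Qed.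

Lemma ler_path_sum (R : numDomainType) (f g : St -> W -> R) s ws :
  (forall s w, f s w <= g s w) -> path_sum f s ws <= path_sum g s ws.
Proof. by move=> fg; elim: ws s => [|w ws ih] s //=; rewrite lerD. Qed.

End PathSums.

(** * Exponential-moment concentration for sums driven by i.i.d. samples *)

Lemma expR_le_quadratic (R : realType) (x : R) :
  x <= 1 / 2 -> expR x <= 1 + x + 2 * x ^+ 2.
Proof.
move=> x2; have x10 : 0 < 1 - x by lra.
have : expR x <= (1 - x)^-1.
  rewrite -[x in expR x]opprK expRN lef_pV2 ?posrE ?expR_gt0//.
  exact: expR_ge1Dx.
move=> /le_trans; apply; rewrite -[leLHS]mul1r ler_pdivrMr//.
(* After exp(x) <= 1/(1 - x), this is the excess of [(1 + x + 2 * x ^+ 2) * (1 - x)] over 1. *)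
have : 0 <= x ^+ 2 * (1 - 2 * x) by rewrite mulr_ge0 ?sqr_ge0//; lra.
have -> : (1 + x + 2 * x ^+ 2) * (1 - x) = 1 + x ^+ 2 * (1 - 2 * x) by ring.
lra.
Qed.

Section Concentration.
Context {R : realType} {St : Type} {W : finType}.
Variables (rho : W -> R) (step : St -> W -> St) (inv : St -> Prop).
Hypothesis rho_dist : is_dist rho.
Hypothesis inv_step : forall s w, inv s -> inv (step s w).

Lemma sum_tuple_cons (T : nat) (F : seq W -> R) :
  \sum_(ws : T.+1.-tuple W) F ws = \sum_w \sum_(ws : T.-tuple W) F (w :: ws).
Proof.
rewrite pair_bigA /= (reindex (fun p : W * T.-tuple W => [tuple of p.1 ::
  p.2])) //=.
exists (fun ws => (thead ws, [tuple of behead ws])) => [[w ws] _|ws _] /=.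
  by congr (_, _); apply: val_inj.
by rewrite -tuple_eta.
Qed.

Lemma sum_tuple_weights (T : nat) :
  \sum_(ws : T.-tuple W) \prod_(w <- ws) rho w = 1.
Proof.
elim: T => [|T ih].
  rewrite (big_pred1 [tuple]) ?big_nil// => ws.
  by rewrite [ws]tuple0; apply/esym/eqP.
rewrite (sum_tuple_cons T (fun ws => \prod_(w <- ws) rho w)) -[RHS]rho_dist.2.
apply: eq_bigr => w _; under eq_bigr do rewrite big_cons.
by rewrite -mulr_sumr ih mulr1.
Qed.

Lemma weight_ge0 (ws : seq W) : 0 <= \prod_(w <- ws) rho w.
Proof. by rewrite prodr_ge0// => w _; exact: rho_dist.1. Qed.

(** Condition on the first sample: the rest is bounded by induction from the new state, and in the
    quadratic bound of the first factor the linear term averages to 0, leaving 1 + 2c^2 <=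
    exp(2c^2). *)
Lemma path_sum_mgf (f : St -> W -> R) (c : R) (T : nat) (s : St) :
  (forall s, inv s -> \sum_w rho w * f s w = 0) ->
  (forall s w, inv s -> `|f s w| <= c) -> c <= 1 / 2 -> inv s ->
  \sum_(ws : T.-tuple W) (\prod_(w <- ws) rho w) * expR (path_sum step f s ws)
  <= expR (2 * c ^+ 2) ^+ T.
Proof.
move=> f0 fc c2; elim: T s => [|T ih] s Is.
  rewrite (big_pred1 [tuple]) ?big_nil ?expr0 /= ?expR0 ?mul1r// => ws.
  by rewrite [ws]tuple0; apply/esym/eqP.
rewrite (sum_tuple_cons T
  (fun ws => (\prod_(w <- ws) rho w) * expR (path_sum step f s ws))).
apply: (@le_trans _ _
    (\sum_w rho w * expR (f s w) * expR (2 * c ^+ 2) ^+ T)).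
  apply: ler_sum => w _.
  under eq_bigr do rewrite big_cons /= expRD mulrACA.
  rewrite -mulr_sumr ler_wpM2l ?mulr_ge0 ?expR_ge0 ?rho_dist.1//.
  by apply: ih; exact: inv_step.
rewrite -mulr_suml (exprS _ T) ler_wpM2r ?exprn_ge0 ?expR_ge0//.
apply: (@le_trans _ _ (\sum_w (rho w * (1 + 2 * c ^+ 2) + rho w * f s w))).
  apply: ler_sum => w _; rewrite -mulrDr ler_wpM2l ?rho_dist.1//.
  have fw := fc s w Is.
  apply: (le_trans (expR_le_quadratic _)).
    by rewrite (le_trans (ler_norm _))// (le_trans fw).
  have : f s w ^+ 2 <= c ^+ 2.
    rewrite -(@real_normK _ (f s w)) ?num_real// ler_pXn2r// nnegrE//.
    exact: le_trans fw.
  lra.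
rewrite big_split/= f0// addr0 -mulr_suml rho_dist.2 mul1r.
exact: expR_ge1Dx.
Qed.

(** Markov's inequality: outside [E] the variable [F] is at least [K]. *)
Lemma markov_tuples (T : nat) (F : T.-tuple W -> R) (K delta : R)
    (E : set (T.-tuple W)) :
  0 < K -> (forall ws, 0 <= F ws) ->
  \sum_(ws : T.-tuple W) (\prod_(w <- ws) rho w) * F ws <= delta * K ->
  (forall ws, F ws < K -> E ws) ->
  1 - delta <= \sum_(ws : T.-tuple W | `[< E ws >]) \prod_(w <- ws) rho w.
Proof.
move=> K0 F0 EF FE; rewrite lerBlDr -[leLHS](sum_tuple_weights T).
rewrite [leLHS](bigID (fun ws => `[< E ws >]))/= lerD2l -(ler_pM2r K0).
apply: le_trans EF; rewrite mulr_suml.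
rewrite [leRHS](bigID (fun ws => `[< E ws >]))/= ler_wpDl//.
  by apply: sumr_ge0 => ws _; rewrite mulr_ge0// weight_ge0.
apply: ler_sum => ws /asboolPn nE; rewrite ler_wpM2l ?weight_ge0//.
by rewrite leNgt; apply/negP => /FE.
Qed.

(** Markov's inequality is applied once, to the sum over [k] of the exponentials; this is a union
    bound costing [ln #|K|]. *)
Lemma path_sum_concentration (K : finType) (f : K -> St -> W -> R) (c : R)
    (T : nat) (s : St) (delta : R) (E : set (T.-tuple W)) :
  (0 < #|K|)%N ->
  (forall k s, inv s -> \sum_w rho w * f k s w = 0) ->
  (forall k s w, inv s -> `|f k s w| <= c) ->
  c <= 1 / 2 -> 2 * c ^+ 2 * T%:R <= 1 -> inv s -> 0 < delta ->
  (forall ws : T.-tuple W,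
    (forall k, path_sum step (f k) s ws <= 1 + ln #|K|%:R + ln delta^-1) ->
    E ws) ->
  1 - delta <= \sum_(ws : T.-tuple W | `[< E ws >]) \prod_(w <- ws) rho w.
Proof.
move=> K0 f0 fc c2 cT Is d0 HE.
have n0 : 0 < #|K|%:R :> R by rewrite ltr0n.
(* Each of the [#|K|] exponentials has mean at most e, since [2 * c ^+ 2 * T <= 1]. *)
set B := #|K|%:R * expR 1 / delta.
have B0 : 0 < B by rewrite divr_gt0 ?mulr_gt0 ?expR_gt0.
have lnB : ln B = 1 + ln #|K|%:R + ln delta^-1.
  rewrite /B !lnM ?posrE ?invr_gt0 ?mulr_gt0 ?expR_gt0// expRK.
  by rewrite (addrC 1).
apply: (@markov_tuples T (fun ws => \sum_k expR (path_sum step (f k) s ws)) B)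
  => //.
- by move=> ws; apply: sumr_ge0 => k _; exact: expR_ge0.
- have -> : delta * B = #|K|%:R * expR 1 by rewrite /B; field; rewrite gt_eqF.
  under eq_bigr do rewrite mulr_sumr.
  rewrite exchange_big /=.
  apply: (@le_trans _ _ (\sum_(k : K) expR 1)); last by rewrite sumr_const
    mulr_natl.
  apply: ler_sum => k _; apply: (le_trans (path_sum_mgf _ (f0 k) (fc k) c2 Is)).
  by rewrite -expRM_natr ler_expR.
- move=> ws FB; apply: HE => k; rewrite -lnB -ler_expR lnK ?posrE//.
  apply: le_trans (ltW FB); rewrite (bigD1 k)//= lerDl.
  by apply: sumr_ge0 => j _; exact: expR_ge0.
Qed.

End Concentration.

(** * Topology and convexity of [Theta], and projection onto it *)

Section ParameterSet.
Context {R : realType} {X A : finType} {d : nat}.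
Variables (Phi : X * A -> 'rV[R]_d) (mu0 : X * A -> R) (S : R).
Hypothesis S_gt0 : 0 < S.
Local Notation Theta := (Theta Phi mu0 S).

Lemma Theta_bounded : exists b, forall z, Theta z -> norm2 z <= b.
Proof. by exists S => z []. Qed.

Lemma Theta_closed : closed Theta.
Proof.
pose a := \sum_z Phi z; pose t := 1 - \sum_z mu0 z.
have -> : Theta = (fun z => dotv z a) @^-1` [set x | x = t] `&`
                  (fun z => dotv z z) @^-1` [set x | x <= S ^+ 2].
  by apply/seteqP; split=> z [/= h1 h2]; split=> //=;
    move: h2; rewrite norm2_le// ltW.
have cid i : continuous (fun z : 'rV[R]_d => z ord0 i).
  exact: coord_continuous.
apply: closedI; apply: closed_comp.
- move=> z _; apply: continuous_dotv => // i; exact: cst_continuous.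
- exact: closed_eq.
- by move=> z _; exact: continuous_dotv.
- exact: closed_le.
Qed.

Lemma Theta_convex u v t :
  Theta u -> Theta v -> 0 <= t <= 1 -> Theta (u + t *: (v - u)).
Proof.
move=> [u1 u2] [v1 v2] /andP[t0 t1]; split.
  by rewrite dotvDl dotvZl dotvBl u1 v1 subrr mulr0 addr0.
have -> : u + t *: (v - u) = (1 - t) *: u + t *: v.
  by rewrite scalerBr scalerBl scale1r addrA addrAC.
rewrite (le_trans (norm2D _ _))// !norm2Z !ger0_norm ?subr_ge0//.
have -> : S = (1 - t) * S + t * S by ring.
by rewrite lerD// ler_wpM2l// subr_ge0.
Qed.

Lemma proj_Theta_in y theta : Theta theta -> Theta (proj Theta y).
Proof.
move=> Tt; have T0 : Theta !=set0 by exists theta.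
by have [] := proj_in_and_obtuse y T0 Theta_closed Theta_bounded Theta_convex.
Qed.

Lemma proj_Theta_nonexpansive y theta : Theta theta ->
  dotv (proj Theta y - theta) (proj Theta y - theta)
  <= dotv (y - theta) (y - theta).
Proof.
move=> Tt.
exact: (proj_nonexpansive y Tt Theta_closed Theta_bounded Theta_convex).
Qed.

End ParameterSet.

(** * The sampled direction as an unbiased subgradient of the penalised cost *)

Section Subgradient.
Context {R : realType} {X A : finType} {d : nat}.
Variables (P : X * A -> X -> R) (ell : X * A -> R) (Phi : X * A -> 'rV[R]_d).
Variables (mu0 : X * A -> R) (q1 : X * A -> R) (q2 : X -> R) (H : R).
Hypothesis ell01 : forall z, 0 <= ell z <= 1.
Hypothesis mu0P : mu0_ok P mu0.
Hypothesis q1_dist : is_dist q1.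
Hypothesis q2_dist : is_dist q2.
Hypothesis q1Phi : forall z, q1 z = 0 -> Phi z = 0.
Hypothesis q2PBPhi : forall x, q2 x = 0 -> PBPhi P Phi x = 0.
Hypothesis H_ge0 : 0 <= H.
Implicit Types (theta v : 'rV[R]_d) (w : (X * A) * X).

Local Notation rho w := (q1 w.1 * q2 w.2).
Local Notation subgrad := (subgrad P ell Phi mu0 q1 q2 H).
Local Notation C1 := (C1 Phi q1).
Local Notation C2 := (C2 P Phi q2).

Definition penalized theta : R :=
  loss ell (lin_mu Phi mu0 theta) + H * (V1 Phi mu0 theta + V2 P Phi mu0 theta).

Lemma sum_product_weights (f : X * A -> R) (g : X -> R) :
  \sum_w rho w * (f w.1 + g w.2) = \sum_z q1 z * f z + \sum_x q2 x * g x.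
Proof.
transitivity (\sum_z \sum_x q1 z * q2 x * (f z + g x)); first by rewrite
  pair_bigA.
transitivity (\sum_z (q1 z * f z + q1 z * \sum_x q2 x * g x)).
  apply: eq_bigr => z _; rewrite -[q1 z * f z]mulr1 -q2_dist.2 !mulr_sumr
    -big_split.
  by apply: eq_bigr => x _ /=; ring.
by rewrite big_split /= -mulr_suml q1_dist.2 mul1r.
Qed.

Lemma sample_dist : is_dist (fun w : (X * A) * X => rho w).
Proof.
split=> [w|]; first by rewrite mulr_ge0 ?q1_dist.1 ?q2_dist.1.
rewrite -(pair_bigA _ (fun z x => q1 z * q2 x)) /= -[RHS]q1_dist.2.
by apply: eq_bigr => z _; rewrite -mulr_sumr q2_dist.2 mulr1.
Qed.

Lemma dotv_subgrad w theta v :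
  dotv (subgrad w theta) v =
  (\sum_z ell z * dotv (Phi z) v
   - H / q1 w.1 * (lin_mu Phi mu0 theta w.1 < 0)%R%:R * dotv (Phi w.1) v)
  + H / q2 w.2 * ((0 < dotv (PBPhi P Phi w.2) theta)%R%:R
                  - (dotv (PBPhi P Phi w.2) theta < 0)%R%:R)
    * dotv (PBPhi P Phi w.2) v.
Proof.
rewrite /Defs.subgrad dotvDl dotvBl !dotvZl dotv_suml.
by under eq_bigr do rewrite dotvZl.
Qed.

(** The importance weights cancel the sampling probabilities. Where such a probability is 0, its
    inverse is 0 by convention, but the feature vector is then 0 too, so no term is lost. *)
Lemma mean_subgrad theta v :
  \sum_w rho w * dotv (subgrad w theta) v =
  \sum_z ell z * dotv (Phi z) v
  - H * (\sum_z (lin_mu Phi mu0 theta z < 0)%R%:R * dotv (Phi z) v)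
  + H * (\sum_x ((0 < dotv (PBPhi P Phi x) theta)%R%:R
                 - (dotv (PBPhi P Phi x) theta < 0)%R%:R)
                * dotv (PBPhi P Phi x) v).
Proof.
under eq_bigr do rewrite dotv_subgrad.
rewrite (sum_product_weights
  (fun z => _ - H / q1 z * (lin_mu Phi mu0 theta z < 0)%R%:R * dotv (Phi z) v)
  (fun x => H / q2 x * ((0 < dotv (PBPhi P Phi x) theta)%R%:R
                  - (dotv (PBPhi P Phi x) theta < 0)%R%:R)
    * dotv (PBPhi P Phi x) v)).
congr (_ + _); last first.
  rewrite mulr_sumr; apply: eq_bigr => x _.
  have [q0|q0] := eqVneq (q2 x) 0; last by field.
  by rewrite (q2PBPhi q0) !dotv0l !mulr0.
under eq_bigr do rewrite mulrBr.
rewrite sumrB -mulr_suml q1_dist.2 mul1r; congr (_ - _).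
rewrite mulr_sumr; apply: eq_bigr => z _.
have [q0|q0] := eqVneq (q1 z) 0; last by field.
by rewrite (q1Phi q0) !dotv0l !mulr0.
Qed.

(** [mu0] has no flow defect, being stationary or 0. *)
Lemma flow_lin_mu theta x' :
  \sum_z (P z x' - Bmx z x') * lin_mu Phi mu0 theta z
  = dotv (PBPhi P Phi x') theta.
Proof.
rewrite /PBPhi dotv_suml.
under eq_bigr do rewrite mulrDr.
rewrite big_split /= [X in X + _ = _](_ : _ = 0) ?add0r; last first.
  case: mu0P => [[_ /(_ x') h]|h].
    by rewrite -[RHS]h; apply: eq_bigr => z _; rewrite mulrC.
  by rewrite big1// => z _; rewrite h mulr0.
by apply: eq_bigr => z _; rewrite dotvZl.
Qed.

Lemma lin_muB theta theta' z :
  lin_mu Phi mu0 theta z - lin_mu Phi mu0 theta' z = dotv (Phi z) (theta -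
    theta').
Proof. by rewrite /lin_mu dotvBr; ring. Qed.

Lemma penalized_subgrad theta theta' :
  penalized theta - penalized theta' <=
  \sum_w rho w * dotv (subgrad w theta) (theta - theta').
Proof.
rewrite mean_subgrad.
have hl : loss ell (lin_mu Phi mu0 theta) - loss ell (lin_mu Phi mu0 theta') =
    \sum_z ell z * dotv (Phi z) (theta - theta').
  rewrite -sumrB; apply: eq_bigr => z _.
  by rewrite -mulrBl lin_muB mulrC.
(* The function |min(u, 0)| is convex, with subgradient -1 for u < 0 and 0 otherwise. *)
have h1 : V1 Phi mu0 theta - V1 Phi mu0 theta' <=
    - \sum_z (lin_mu Phi mu0 theta z < 0)%R%:R * dotv (Phi z) (theta - theta').
  rewrite -sumrB -sumrN; apply: ler_sum => z _; rewrite -lin_muB.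
  case: (ltP (lin_mu Phi mu0 theta z) 0) => hz; rewrite /= ?normr0.
    rewrite (ltr0_norm hz) mul1r.
    have := ler_norm (- Num.min (lin_mu Phi mu0 theta' z) 0); rewrite normrN.
    have : Num.min (lin_mu Phi mu0 theta' z) 0 <= lin_mu Phi mu0 theta' z.
      by rewrite ge_min lexx.
    lra.
  by rewrite mul0r oppr0 add0r oppr_le0.
(* The sign, taken as 0 at 0, is a subgradient of the absolute value. *)
have h2 : V2 P Phi mu0 theta - V2 P Phi mu0 theta' <=
    \sum_x ((0 < dotv (PBPhi P Phi x) theta)%R%:R
            - (dotv (PBPhi P Phi x) theta < 0)%R%:R)
           * dotv (PBPhi P Phi x) (theta - theta').
  rewrite -sumrB; apply: ler_sum => x _; rewrite !flow_lin_mu dotvBr.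
  set a := dotv _ theta; set b := dotv _ theta'.
  have := ler_norm b; have := ler_norm (- b); rewrite normrN.
  by case: (ltrgt0P a) => [a0|a0|->] /=; lra.
have h3 := ler_wpM2l H_ge0 h1; have h4 := ler_wpM2l H_ge0 h2.
rewrite /penalized; lra.
Qed.

Lemma C1_bound z : norm2 (Phi z) / q1 z <= C1.
Proof. exact: (le_bigmax (0 : R) (fun z => norm2 (Phi z) / q1 z)). Qed.

Lemma C2_bound x : norm2 (PBPhi P Phi x) / q2 x <= C2.
Proof. exact: (le_bigmax (0 : R) (fun x => norm2 (PBPhi P Phi x) / q2 x)). Qed.

Lemma C1_ge0 : 0 <= C1.
Proof. exact: bigmax_ge_id. Qed.

Lemma C2_ge0 : 0 <= C2.
Proof. exact: bigmax_ge_id. Qed.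

(* The loss part is at most C1 because q1 has mass 1, so that no normalisation
   of the features is needed. *)
Lemma dotv_subgrad_le w theta v :
  `|dotv (subgrad w theta) v| <= (C1 + H * (C1 + C2)) * norm2 v.
Proof.
have v0 := norm2_ge0 v.
have h0 : `|\sum_z ell z * dotv (Phi z) v| <= C1 * norm2 v.
  apply: (le_trans (ler_norm_sum _ _ _)).
  rewrite -[leRHS]mul1r -q1_dist.2 mulr_suml; apply: ler_sum => z _.
  have /andP[l0 l1] := ell01 z.
  have hz : norm2 (Phi z) <= q1 z * C1.
    have [q0|q0] := eqVneq (q1 z) 0; first by rewrite (q1Phi q0) norm20 q0
      mul0r.
    have qz : 0 < q1 z by rewrite lt0r q0 q1_dist.1.
    by rewrite mulrC -ler_pdivrMr// C1_bound.
  rewrite normrM (ger0_norm l0) (le_trans (ler_piMl _ _))//.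
  by rewrite (le_trans (cauchy_schwarz _ _))// mulrA ler_wpM2r.
(* Serves both importance-weighted terms, with [b] the indicator or the sign. *)
have h1 (q : R) (b : R) (u : 'rV[R]_d) (C : R) : 0 <= q -> `|b| <= 1 ->
    norm2 u / q <= C -> `|H / q * b * dotv u v| <= H * C * norm2 v.
  move=> q0 b1 uC; rewrite !normrM (ger0_norm H_ge0) ger0_norm ?invr_ge0//.
  apply: (@le_trans _ _ (H / q * 1 * (norm2 u * norm2 v))).
    rewrite ler_pM ?mulr_ge0 ?invr_ge0 ?cauchy_schwarz//.
    by rewrite ler_wpM2l// mulr_ge0 ?invr_ge0.
  rewrite mulr1 mulrA ler_wpM2r// -mulrA ler_wpM2l//.
  by rewrite mulrC.
rewrite dotv_subgrad (le_trans (ler_normD _ _))// (le_trans (lerD (ler_normB _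
  _) (lexx _)))//.
have -> : (C1 + H * (C1 + C2)) * norm2 v =
  C1 * norm2 v + H * C1 * norm2 v + H * C2 * norm2 v by ring.
apply: lerD; first apply: lerD => //.
- apply: h1; rewrite ?q1_dist.1 ?C1_bound//.
  by case: (_ < 0); rewrite ?normr0 ?normr1.
- apply: h1; rewrite ?q2_dist.1 ?C2_bound//.
  by case: (ltrgt0P (dotv _ theta)) => _ /=; rewrite ?subr0 ?sub0r ?normrN
    ?normr0 ?normr1.
Qed.

End Subgradient.

(** * Regret of projected stochastic subgradient descent and its averaged output *)

Section Algorithm.
Context {R : realType} {X A : finType} {d : nat}.
Variables (P : X * A -> X -> R) (ell : X * A -> R) (Phi : X * A -> 'rV[R]_d).
Variables (mu0 : X * A -> R) (S : R) (q1 : X * A -> R) (q2 : X -> R) (H eta :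
  R).
Hypothesis mu0P : mu0_ok P mu0.
Hypothesis q1_dist : is_dist q1.
Hypothesis q2_dist : is_dist q2.
Hypothesis q1Phi : forall z, q1 z = 0 -> Phi z = 0.
Hypothesis q2PBPhi : forall x, q2 x = 0 -> PBPhi P Phi x = 0.
Hypothesis S_gt0 : 0 < S.
Hypothesis H_ge0 : 0 <= H.
Implicit Types (theta s v : 'rV[R]_d) (w : (X * A) * X).

Local Notation W := ((X * A) * X)%type.
Local Notation rho w := (q1 w.1 * q2 w.2).
Local Notation Theta := (Theta Phi mu0 S).
Local Notation subgrad := (subgrad P ell Phi mu0 q1 q2 H).
Local Notation pen := (penalized P ell Phi mu0 H).
Local Notation that := (theta_hat P ell Phi mu0 S q1 q2 H eta).

Definition sgd_step s w : 'rV[R]_d := proj Theta (s - eta *: subgrad w s).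

Definition mean_dotv s v : R := \sum_w rho w * dotv (subgrad w s) v.

Lemma sgd_step_norm2 theta s w : Theta theta -> norm2 (sgd_step s w) <= S.
Proof. by move=> Tt; have [] := proj_Theta_in S_gt0 (s - eta *: subgrad w s)
  Tt. Qed.

Lemma foldl_sgd_in theta (ws : seq W) : Theta theta -> (0 < size ws)%N ->
  Theta (foldl sgd_step 0 ws).
Proof.
move=> Tt; case/lastP: ws => // ws w _.
by rewrite foldl_rcons; exact: proj_Theta_in Tt.
Qed.

(* The first iterate 0 need not belong to Theta: hence the defect 1 / T. *)
Lemma mass_theta_hat theta T (ws : T.-tuple W) : Theta theta -> (0 < T)%N ->
  `|\sum_z lin_mu Phi mu0 (that ws) z - 1| <= T%:R^-1.
Proof.
move=> Tt T0; set m := \sum_z mu0 z.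
have m01 : 0 <= 1 - m <= 1.
  case: mu0P => [[[_ m1] _]|h]; rewrite /m ?m1 ?subrr ?lexx ?ler01//.
  by rewrite big1 ?subr0 ?lexx ?ler01.
have -> : \sum_z lin_mu Phi mu0 (that ws) z = m + dotv (that ws) (\sum_z Phi z).
  by rewrite /lin_mu big_split /= dotvC dotv_suml.
have Tn0 : T%:R != 0 :> R by rewrite pnatr_eq0 -lt0n.
have -> : dotv (that ws) (\sum_z Phi z) = T%:R^-1 * ((T%:R - 1) * (1 - m)).
  rewrite dotvZl dotv_suml; congr (_ * _).
  case: T ws T0 {Tn0} => // T ws _.
  rewrite big_ord_recl take0 dotv0l add0r.
  rewrite (eq_bigr (fun=> 1 - m)) => [|t _]; last first.
    have [] // := @foldl_sgd_in theta (take (lift ord0 t) ws) Tt _.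
    by rewrite size_take size_tuple ltn_ord.
  by rewrite sumr_const card_ord -natr1 addrK mulr_natl.
have -> : m + T%:R^-1 * ((T%:R - 1) * (1 - m)) - 1 = - (T%:R^-1 * (1 - m)).
  by field.
have T1 : 0 <= T%:R^-1 :> R by rewrite invr_ge0.
case/andP: m01 => m0 m1.
by rewrite normrN normrM !ger0_norm// ler_piMr.
Qed.

Lemma mean_dotvB s u v : mean_dotv s (u - v) = mean_dotv s u - mean_dotv s v.
Proof.
by rewrite -sumrB; apply: eq_bigr => w _; rewrite dotvBr mulrBr.
Qed.

Lemma mean_dotvZ s c v : mean_dotv s (c *: v) = c * mean_dotv s v.
Proof. by rewrite mulr_sumr; apply: eq_bigr => w _; rewrite dotvZr mulrCA. Qed.

Lemma mean_dotv_sum s (I : finType) (F : I -> 'rV[R]_d) :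
  mean_dotv s (\sum_i F i) = \sum_i mean_dotv s (F i).
Proof.
rewrite exchange_big; apply: eq_bigr => w _.
by rewrite dotv_sumr mulr_sumr.
Qed.

Lemma mean_dotv_le s v b :
  (forall w, `|dotv (subgrad w s) v| <= b) -> `|mean_dotv s v| <= b.
Proof.
have [rho0 rho1] := sample_dist q1_dist q2_dist.
move=> hb; apply: (le_trans (ler_norm_sum _ _ _)).
rewrite -[leRHS]mul1r -rho1 mulr_suml; apply: ler_sum => w _.
by rewrite normrM (ger0_norm (rho0 w)) ler_wpM2l.
Qed.

(** Jensen's inequality followed by the subgradient inequality at each iterate. *)
Lemma penalized_average theta T (ws : T.-tuple W) : (0 < T)%N ->
  T%:R * (pen (that ws) - pen theta) <=
  path_sum sgd_step (fun s _ => mean_dotv s (s - theta)) 0 ws.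
Proof.
move=> T0.
have Tn0 : T%:R != 0 :> R by rewrite pnatr_eq0 -lt0n.
have subg := penalized_subgrad ell mu0P q1_dist q2_dist q1Phi q2PBPhi H_ge0.
apply: (@le_trans _ _ (path_sum sgd_step (fun s _ => pen s - pen theta) 0 ws));
  last first.
  by apply: ler_path_sum => s w; exact: subg.
rewrite (path_sumE sgd_step (fun s => pen s - pen theta)) size_tuple.
rewrite sumrB sumr_const card_ord mulrBr !mulr_natl lerD2r -subr_le0.
have <- : \sum_(t < T) pen (that ws) = pen (that ws) *+ T.
  by rewrite sumr_const card_ord.
rewrite -sumrB.
set th := that ws.
(* Jensen from the subgradient at the average [th]: the differences [th - theta_t] sum to 0. *)
apply: (@le_trans _ _ (\sum_(t < T)
    mean_dotv th (th - foldl sgd_step 0 (take t ws)))).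
  by apply: ler_sum => t _; exact: subg.
rewrite -mean_dotv_sum sumrB sumr_const card_ord.
have -> : th *+ T = \sum_(t < T) foldl sgd_step 0 (take t ws).
  by rewrite /th /theta_hat -scaler_nat scalerA divff// scale1r.
by rewrite subrr -(scale0r 0) mean_dotvZ mul0r.
Qed.

(** The squared distance to [theta] telescopes: projection does not increase it, and expanding the
    square of the unprojected step gives the regret term and [eta ^+ 2 * G ^+ 2]. *)
Lemma sgd_regret theta s G (ws : seq W) : Theta theta ->
  (forall s w, norm2 (subgrad w s) <= G) ->
  2 * eta * path_sum sgd_step (fun s w => dotv (subgrad w s) (s - theta)) s ws
  <= dotv (s - theta) (s - theta) + eta ^+ 2 * G ^+ 2 * (size ws)%:R.
Proof.
move=> Tt hG; elim: ws s => [|w ws ih] s.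
  by rewrite /= !mulr0 addr0 dotv_ge0.
rewrite /= mulrDr -(natr1 (size ws)) (mulrDr (eta ^+ 2 * G ^+ 2)) mulr1.
have := ih (sgd_step s w).
have := proj_Theta_nonexpansive S_gt0 (s - eta *: subgrad w s) Tt.
rewrite -/(sgd_step s w).
set g := subgrad w s; set s' := sgd_step s w.
have -> : s - eta *: g - theta = (s - theta) - eta *: g by rewrite addrAC.
have gE : dotv g (s - theta) = dotv (s - theta) g := dotvC _ _.
move: (s - theta) gE => r gE; rewrite [in X in _ <= X]dotvBl !(dotvBr r).
have : eta ^+ 2 * dotv g g <= eta ^+ 2 * G ^+ 2.
  by rewrite ler_wpM2l ?sqr_ge0// -norm2_le ?hG// (le_trans _ (hG s w))//
    norm2_ge0.
rewrite !dotvZr !dotvZl gE; lra.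
Qed.

End Algorithm.

(** * Excess penalised cost, uniformly over [Theta] with high probability *)

Section HighProbability.
Context {R : realType} {X A : finType} {d : nat}.
Variables (P : X * A -> X -> R) (ell : X * A -> R) (Phi : X * A -> 'rV[R]_d).
Variables (mu0 : X * A -> R) (S : R) (q1 : X * A -> R) (q2 : X -> R) (H : R).
Variables (G : R) (T : nat).
Hypothesis mu0P : mu0_ok P mu0.
Hypothesis q1_dist : is_dist q1.
Hypothesis q2_dist : is_dist q2.
Hypothesis q1Phi : forall z, q1 z = 0 -> Phi z = 0.
Hypothesis q2PBPhi : forall x, q2 x = 0 -> PBPhi P Phi x = 0.
Hypothesis S_gt0 : 0 < S.
Hypothesis H_ge0 : 0 <= H.
Hypothesis G_gt0 : 0 < G.
Hypothesis T_gt0 : (0 < T)%N.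

Local Notation W := ((X * A) * X)%type.
Local Notation subgrad := (subgrad P ell Phi mu0 q1 q2 H).
Local Notation eta := (S / (G * Num.sqrt T%:R)).
Local Notation step := (sgd_step P ell Phi mu0 S q1 q2 H eta).
Local Notation mean_dotv := (mean_dotv P ell Phi mu0 q1 q2 H).
Local Notation Theta := (Theta Phi mu0 S).
Local Notation pen := (penalized P ell Phi mu0 H).
Local Notation that := (theta_hat P ell Phi mu0 S q1 q2 H eta).

Hypothesis dotv_subgrad2G :
  forall w s v, `|dotv (subgrad w s) v| <= 2 * G * norm2 v.

(* The noise tested against s / S and against the signed basis vectors
   controls the noise tested against s - theta for all theta at once. *)
Let test (k : option ('I_d * bool)) (s : 'rV[R]_d) : 'rV[R]_d :=
  if k is Some (i, b) then (-1) ^+ b *: delta_mx ord0 i else S^-1 *: s.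

(** Scaled so that [noise], a difference of two terms of size at most [2 * G], is at most
    [c = 1 / (2 * sqrt T)]; then [c <= 1 / 2] and [2 * c ^+ 2 * T = 1 / 2]. *)
Let N : R := 8 * G * Num.sqrt T%:R.

Let noise k s w : R := (mean_dotv s (test k s) - dotv (subgrad w s) (test k s))
  / N.

Let sqT_gt0 : 0 < Num.sqrt T%:R :> R.
Proof. by rewrite sqrtr_gt0 ltr0n. Qed.

Let N_gt0 : 0 < N.
Proof. by rewrite !mulr_gt0. Qed.

Let norm2_test k s : norm2 s <= S -> norm2 (test k s) <= 1.
Proof.
move=> sS; case: k => [[i b]|] /=.
  by rewrite norm2Z norm2_delta mulr1 normrX normrN1 expr1n.
by rewrite norm2Z ger0_norm ?invr_ge0 ?(ltW S_gt0)// mulrC ler_pdivrMr// mul1r.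
Qed.

Let noise_mean k s : \sum_w q1 w.1 * q2 w.2 * noise k s w = 0.
Proof.
have [_ rho1] := sample_dist q1_dist q2_dist.
under eq_bigr do rewrite /noise mulrA mulrBr.
by rewrite -mulr_suml sumrB -mulr_suml rho1 mul1r subrr mul0r.
Qed.

Let noise_le k s w : norm2 s <= S -> `|noise k s w| <= (2 * Num.sqrt T%:R)^-1.
Proof.
move=> sS; rewrite normrM (@ger0_norm _ N^-1) ?invr_ge0 ?(ltW N_gt0)//.
have h w' : `|dotv (subgrad w' s) (test k s)| <= 2 * G.
  by rewrite (le_trans (dotv_subgrad2G _ _ _))// ler_piMr ?norm2_test//
    mulr_ge0// ltW.
rewrite ler_pdivrMr// (_ : _^-1 * N = 2 * G + 2 * G); last first.
  by rewrite /N; field; rewrite gt_eqF.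
by rewrite (le_trans (ler_normB _ _))// lerD// mean_dotv_le.
Qed.

(** Linearity in [s - theta], expanding [theta] in the basis. The coefficients do not depend on the
    state, so they factor out of path sums. *)
Let noise_decomposition theta s w :
  mean_dotv s (s - theta) = dotv (subgrad w s) (s - theta)
  + (N * S * noise None s w
     + \sum_i (- (N * theta ord0 i)) * noise (Some (i, false)) s w).
Proof.
have Nn k : N * noise k s w = mean_dotv s (test k s) - dotv (subgrad w s) (test
  k s).
  by rewrite /noise mulrC divfK// gt_eqF.
have -> : N * S * noise None s w = mean_dotv s s - dotv (subgrad w s) s.
  rewrite mulrAC Nn /= mean_dotvZ dotvZr; field; rewrite gt_eqF//.
rewrite (_ : \sum_i _ = - (mean_dotv s theta - dotv (subgrad w s) theta)).
  by rewrite mean_dotvB dotvBr; ring.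
rewrite {2 3}(row_sum_delta theta) mean_dotv_sum dotv_sumr -sumrB -sumrN.
apply: eq_bigr => i _; rewrite mulNr mulrAC Nn /= expr0 scale1r.
by rewrite mean_dotvZ dotvZr; ring.
Qed.

(** Turns the one-sided bounds for both signs into a bound on the absolute value. *)
Let noise_opp i s (ws : seq W) :
  path_sum step (noise (Some (i, true))) s ws
  = - path_sum step (noise (Some (i, false))) s ws.
Proof.
rewrite (path_sum_morph _ _ _ _ (oppr0 R) (@opprD R)).
apply: eq_path_sum => s' w; rewrite /noise /= expr1 expr0 !mean_dotvZ !dotvZr.
by ring.
Qed.

Let regret_le theta (ws : T.-tuple W) : Theta theta ->
  path_sum step (fun s w => dotv (subgrad w s) (s - theta)) 0 ws
  <= 3 * (S * G * Num.sqrt T%:R).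
Proof.
move=> Tt.
have hG s w : norm2 (subgrad w s) <= 2 * G.
  have := dotv_subgrad2G w s (subgrad w s).
  rewrite ger0_norm ?dotv_ge0// -norm2_sqr.
  have := norm2_ge0 (subgrad w s); rewrite le_eqVlt => /orP[/eqP <- _|g0].
    by rewrite mulr_ge0// ltW.
  by rewrite expr2 ler_pM2r.
have eta0 : 0 < eta by rewrite divr_gt0 ?mulr_gt0.
have := sgd_regret eta S_gt0 0 ws Tt hG; set r := path_sum _ _ _ _.
rewrite size_tuple sub0r dotvNl dotvNr opprK.
(* With |theta|^2 <= S^2 the regret bound totals 5 S^2, rounded up to 6 S^2 below. *)
have -> : eta ^+ 2 * (2 * G) ^+ 2 * T%:R = 4 * S ^+ 2.
  rewrite -{2}(@sqr_sqrtr _ T%:R) ?ler0n//.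
  by field; rewrite !gt_eqF.
have : dotv theta theta <= S ^+ 2 by rewrite -norm2_le ?Tt.2 ?ltW.
move=> h1 h2; rewrite -(@ler_pM2l _ (2 * eta)) ?(mulr_gt0 _ eta0)//.
have -> : 2 * eta * (3 * (S * G * Num.sqrt T%:R)) = 6 * S ^+ 2.
  by field; rewrite !gt_eqF.
have := sqr_ge0 S; lra.
Qed.

Lemma excess_high_probability theta0 (delta : R) (E : set (T.-tuple W)) :
  Theta theta0 -> 0 < delta ->
  (forall ws, (forall theta, Theta theta ->
     pen (that ws) - pen theta <=
     S * (G / Num.sqrt T%:R)
       * (3 + 8 * (1 + 2 * d%:R + ln delta^-1) * (1 + d%:R))) -> E ws) ->
  1 - delta <= Pr_samples q1 q2 E.
Proof.
move=> Tt0 delta0 HE.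
have T1 : 1 <= Num.sqrt T%:R :> R.
  by have := @ler_wsqrtr R 1 T%:R; rewrite sqrtr1 ler1n; apply.
apply: (@path_sum_concentration _ _ _ _ step (fun s => norm2 s <= S) _ _
  _ noise (2 * Num.sqrt T%:R)^-1 _ 0) => //.
- exact: sample_dist.
- by move=> s w _; exact: sgd_step_norm2 Tt0.
- by rewrite card_option.
- by rewrite [leRHS]mul1r lef_pV2 ?posrE ?mulr_gt0// ler_peMr.
- rewrite -{2}(@sqr_sqrtr _ T%:R) ?ler0n//.
  rewrite (_ : 2 * _ * _ = 1 / 2); first by lra.
  by field; rewrite gt_eqF.
- by rewrite norm20 ltW.
move=> ws hws; apply: HE => theta Tt.
set a := 1 + 2 * d%:R + ln delta^-1.
(* There are [2 * d + 1] tests, and ln(1 + 2d) <= 2d keeps the bound polynomial. *)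
have {}hws k : path_sum step (noise k) 0 ws <= a.
  apply: (le_trans (hws k)); rewrite lerD2r lerD2l card_option card_prod
    card_ord card_bool.
  rewrite -natr1 addrC -natrM mulnC; apply: le_ln1Dx.
  by rewrite (lt_le_trans (ltrN10 _)).
have := penalized_average ell S eta mu0P q1_dist q2_dist q1Phi q2PBPhi H_ge0
  theta ws T_gt0.
rewrite (eq_path_sum _ _ _ (fun s w => noise_decomposition theta s w)).
rewrite !path_sumD [X in _ + (_ + X)]path_sum_sum.
have pZ c k : path_sum step (fun s w => c * noise k s w) 0 ws =
    c * path_sum step (noise k) 0 ws.
  by rewrite (path_sum_morph _ _ _ _ (mulr0 c) (mulrDr c)).
rewrite pZ (eq_bigr _ (fun i _ => pZ (- (N * theta ord0 i)) (Some (i, false)))).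
have h0 : N * S * path_sum step (noise None) 0 ws <= N * S * a.
  by rewrite ler_wpM2l// mulr_ge0 ?ltW.
have h1 : \sum_i (- (N * theta ord0 i)) * path_sum step (noise (Some (i,
  false))) 0 ws
    <= d%:R * (N * S * a).
  have -> : d%:R * (N * S * a) = \sum_(i < d) N * S * a.
    by rewrite sumr_const card_ord mulr_natl.
  apply: ler_sum => i _; set y := path_sum _ _ _ _.
  have ya : `|y| <= a.
    by rewrite ler_norml lerNl -noise_opp !hws.
  have ti : `|theta ord0 i| <= S := le_trans (coord_le_norm2 _ _) Tt.2.
  apply: (le_trans (ler_norm _)); rewrite normrM normrN normrM.
  by rewrite ler_pM// ?mulr_ge0// (ger0_norm (ltW N_gt0)) ler_wpM2l// ltW.
have h2 := regret_le ws Tt.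
move=> h; rewrite -(@ler_pM2l _ T%:R) ?ltr0n//; apply: (le_trans h).
have -> : T%:R * (S * (G / Num.sqrt T%:R) * (3 + 8 * a * (1 + d%:R))) =
    3 * (S * G * Num.sqrt T%:R) + (N * S * a + d%:R * (N * S * a)).
  rewrite -{1}(@sqr_sqrtr _ T%:R) ?ler0n// /N.
  by field; rewrite gt_eqF.
lra.
Qed.

End HighProbability.

(** * The error constant as a polynomial, and the arithmetic of the final bound *)

Definition sgd_const (K : pzRingType) (S d C1 C2 L : K) : K :=
  2 * S * (d + C1 + C2) * (3 + 8 * (1 + 2 * d + L) * (1 + d)).

(* t and t' stand for the mixing times of the comparator and of the output. *)
Definition error_const (K : pzRingType) (S d C1 C2 L t t' : K) : K :=
  let B := sgd_const S d C1 C2 L in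
  2 + 6 * (1 + t) + B + (1 + t') * (12 * (2 + 6 * (1 + t) + B) + 2).

(** [error_const] is generic in its ring so that one expression serves as a polynomial here and as a
    real number in the estimates. *)
Definition error_poly (R : realType) : mpoly.mpoly 9 R :=
  let x k (hk : (k < 9)%N) : mpoly.mpoly 9 R :=
    mpoly.mpolyX R (mpoly.mnm1 (Ordinal hk)) in
  error_const (x 0%N isT) (x 1%N isT) (x 2%N isT) (x 3%N isT) (x 4%N isT)
    (x 7%N isT) (x 8%N isT).

Lemma meval_error_poly (R : realType) (S d C1 C2 L v1 v2 t t' : R) :
  mpoly.meval (fun i : 'I_9 => [:: S; d; C1; C2; L; v1; v2; t; t']`_i)
    (error_poly R) = error_const S d C1 C2 L t t'.
Proof.
rewrite /error_poly /error_const /sgd_const.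
by rewrite !(rmorphD, rmorphM, rmorph1, rmorph_nat) /= !mpoly.mevalXU.
Qed.

Section ErrorBound.
Context {R : realType}.
Implicit Types (S C L t : R).

Lemma sgd_const_ge0 S (d : nat) C1 C2 L :
  0 <= S -> 0 <= C1 -> 0 <= C2 -> 0 <= L -> 0 <= sgd_const S d%:R C1 C2 L.
Proof. by move=> *; rewrite !(mulr_ge0, addr_ge0). Qed.

(** For [eps > 1 / 2] this makes the error term exceed 1, the largest possible loss. *)
Lemma error_const_ge2 S (d : nat) C1 C2 L t t' :
  0 <= S -> 0 <= C1 -> 0 <= C2 -> 0 <= L -> 0 <= t -> 0 <= t' ->
  2 <= error_const S d%:R C1 C2 L t t'.
Proof.
move=> S0 C10 C20 L0 t0 t'0.
have B0 := sgd_const_ge0 d S0 C10 C20 L0.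
rewrite /error_const /=; set B := sgd_const _ _ _ _ _ in B0 *.
have : 0 <= (1 + t') * (12 * (2 + 6 * (1 + t) + B) + 2).
  by rewrite !(mulr_ge0, addr_ge0).
lra.
Qed.

(** [sqrt T] is of order eps^-2, and one of the two factors eps gained absorbs the multiplier
    [eps^-1]. The 4 leaves room for rounding [T]. *)
Lemma sgd_rate (eps S C1 C2 L : R) (d T : nat) :
  0 < eps <= 1 / 2 -> (4 * eps ^+ 4)^-1 <= T%:R ->
  0 <= S -> 0 <= C1 -> 0 <= C2 -> 0 <= L ->
  S * ((Num.sqrt d%:R + eps^-1 * (C1 + C2)) / Num.sqrt T%:R)
    * (3 + 8 * (1 + 2 * d%:R + L) * (1 + d%:R))
  <= eps * sgd_const S d%:R C1 C2 L.
Proof.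
move=> /andP[e0 e2] hT S0 C10 C20 L0; rewrite /sgd_const.
have -> : eps * (2 * S * (d%:R + C1 + C2) * (3 + 8 * (1 + 2 * d%:R + L) * (1 +
  d%:R)))
    = S * (2 * eps * (d%:R + C1 + C2)) * (3 + 8 * (1 + 2 * d%:R + L) * (1 +
      d%:R)).
  by ring.
rewrite ler_wpM2r ?(mulr_ge0, addr_ge0)// ler_wpM2l//.
have sT : (2 * eps ^+ 2)^-1 <= Num.sqrt T%:R.
  have p0 : 0 <= (2 * eps ^+ 2)^-1 by rewrite invr_ge0 mulr_ge0// sqr_ge0.
  rewrite -(ger0_norm p0) -sqrtr_sqr ler_wsqrtr// (le_trans _ hT)//.
  by rewrite (_ : (2 * eps ^+ 2)^-1 ^+ 2 = (4 * eps ^+ 4)^-1)//; field; rewrite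
    gt_eqF.
have sT0 : 0 < Num.sqrt T%:R :> R.
  by rewrite (lt_le_trans _ sT)// invr_gt0 mulr_gt0// exprn_gt0.
have sd : Num.sqrt d%:R <= d%:R :> R.
  case: d => [|d]; first by rewrite sqrtr0.
  rewrite -[leRHS]ger0_norm// -sqrtr_sqr ler_wsqrtr// expr2 -natrM ler_nat.
  by rewrite leq_pmulr.
rewrite ler_pdivrMr//.
apply: (@le_trans _ _ (2 * eps * (d%:R + C1 + C2) * (2 * eps ^+ 2)^-1)); last
  first.
  by rewrite ler_wpM2l// ?(mulr_ge0, addr_ge0)// ltW.
have -> : 2 * eps * (d%:R + C1 + C2) * (2 * eps ^+ 2)^-1
    = eps^-1 * d%:R + eps^-1 * (C1 + C2) by field; rewrite gt_eqF.
rewrite lerD2r (le_trans sd)// ler_peMl// -invr1 lef_pV2 ?posrE//; lra.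
Qed.

(* A large multiplier forces the violation V' of the output down to O(eps),
   since its linear loss lu' is at least -V'. *)
Lemma combine_bounds (eps M M' lu lu' V V' t t' B : R) :
  0 < eps <= 1 / 2 -> V <= eps -> 0 <= V' -> 0 <= B -> 0 <= t -> 0 <= t' ->
  M <= 1 ->
  M' <= lu' + (1 + t') * (6 * V' + 3 * (eps / 2)) ->
  lu' + eps^-1 * V' <= lu + eps^-1 * V + eps * B ->
  - lu' <= V' ->
  lu <= M + (1 + t) * (6 * V) ->
  M' <= M + eps^-1 * V
    + eps * (2 + 6 * (1 + t) + B + (1 + t') * (12 * (2 + 6 * (1 + t) + B) + 2)).
Proof.
move=> /andP[e0 e2] Ve V'0 B0 t0 t'0 M1 hM' hpen hlu' hlu.
have hV : (1 + t) * (6 * V) <= 6 * (eps * (1 + t)).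
  rewrite (_ : 6 * (eps * (1 + t)) = (1 + t) * (6 * eps)); last by ring.
  by rewrite ler_wpM2l ?addr_ge0// ler_wpM2l.
have HV : eps^-1 * V <= 1 by rewrite mulrC ler_pdivrMr// mul1r.
have eB : eps * B <= B by rewrite ler_piMl//; lra.
have et : eps * (1 + t) <= 1 + t by rewrite ler_piMl ?addr_ge0//; lra.
set Q := 2 + 6 * (1 + t) + B.
(* From [eps^-1 * V' <= Q + V']: after multiplying by [eps <= 1 / 2], half of [V'] is absorbed on
   the left. *)
have V'Q : V' <= 2 * (eps * Q).
  have : eps^-1 * V' <= Q + V' by rewrite /Q; lra.
  rewrite mulrC ler_pdivrMr// => h.
  have : eps * V' <= 1 / 2 * V' by rewrite ler_wpM2r.
  lra.
have h1 : (1 + t') * (6 * V' + 3 * (eps / 2)) <= (1 + t') * (12 * (eps * Q) + 2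
  * eps).
  rewrite ler_wpM2l ?addr_ge0//; lra.
have : 0 <= eps^-1 * V' by rewrite mulr_ge0// invr_ge0 ltW.
have -> : eps * (Q + (1 + t') * (12 * Q + 2)) =
  (2 * eps + 6 * (eps * (1 + t)) + eps * B) + (1 + t') * (12 * (eps * Q) + 2 *
    eps).
  by rewrite /Q; ring.
lra.
Qed.

(** Only negative entries can make the linear loss negative, each with weight at most 1. *)
Lemma loss_lower_bound (X A : finType) (d : nat) (ell : X * A -> R)
    (Phi : X * A -> 'rV[R]_d) (mu0 : X * A -> R) theta :
  (forall z, 0 <= ell z <= 1) ->
  - loss ell (lin_mu Phi mu0 theta) <= V1 Phi mu0 theta.
Proof.
move=> l01; rewrite -sumrN; apply: ler_sum => z _.
have /andP[l0 l1] := l01 z; set u := lin_mu _ _ _ _.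
case: (leP u 0) => u0; rewrite ?normr0.
  by rewrite (ler0_norm u0) -mulNr ler_piMr// oppr_ge0.
by rewrite oppr_le0 mulr_ge0// ltW.
Qed.

Lemma Pr_samples_sure (X A : finType) (q1 : X * A -> R) (q2 : X -> R) (T : nat)
    (delta : R) (E : set (T.-tuple ((X * A) * X))) :
  is_dist q1 -> is_dist q2 -> 0 <= delta -> (forall ws, E ws) ->
  1 - delta <= Pr_samples q1 q2 E.
Proof.
move=> d1 d2 d0 hE; rewrite /Pr_samples (eq_bigl xpredT) => [|ws]; last first.
  by apply/asboolP.
by rewrite (sum_tuple_weights (sample_dist d1 d2)) gerBl.
Qed.

End ErrorBound.

(** * Oracle inequality for the output policy: degenerate cases, then [eps <= 1 / 2] *)

Theorem theorem1 (R : realType) :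
  exists p : mpoly.mpoly 9 R,
  forall (X A : finType) (d : nat)
    (ell : X * A -> R) (P : X * A -> X -> R) (tau : (X -> A -> R) -> R)
    (Phi : X * A -> 'rV[R]_d) (mu0 : X * A -> R) (pi0 : X -> A -> R) (S : R)
    (q1 : X * A -> R) (q2 : X -> R),
  (forall z, 0 <= ell z <= 1) ->
  is_kernel P ->
  fast_mixing P tau ->
  mu0_ok P mu0 ->
  is_policy pi0 ->
  0 < S ->
  is_dist q1 ->
  is_dist q2 ->
  (* C1 and C2 are finite *)
  (forall z, q1 z = 0 -> Phi z = 0) ->
  (forall x, q2 x = 0 -> PBPhi P Phi x = 0) ->
  forall eps : R, 0 < eps < 1 ->
  (* T = 1 / eps ^ 4 up to rounding to an integer *)
  forall T : nat, `|T%:R - (eps ^+ 4)^-1| < 1 ->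
  let H := eps^-1 in
  let G' := Num.sqrt d%:R + H * (C1 Phi q1 + C2 P Phi q2) in
  let eta := S / (G' * Num.sqrt T%:R) in
  let pol := pi_theta Phi mu0 pi0 in
  forall delta : R, 0 < delta < 1 ->
  1 - delta <=
  Pr_samples q1 q2 [set ws : T.-tuple ((X * A) * X) |
    let that := theta_hat P ell Phi mu0 S q1 q2 H eta ws in
    forall theta, Theta Phi mu0 S theta ->
      loss ell (mu_pol P (pol that)) <=
      loss ell (mu_pol P (pol theta))
      + eps^-1 * (V1 Phi mu0 theta + V2 P Phi mu0 theta)
      + eps * mpoly.meval (fun i : 'I_9 =>
                [:: S; d%:R; C1 Phi q1; C2 P Phi q2; ln (delta^-1);
                    V1 Phi mu0 theta; V2 P Phi mu0 theta;
                    tau (pol theta); tau (pol that)]`_i) p].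
Proof.
exists (error_poly R).
move=> X A d ell P tau Phi mu0 pi0 S q1 q2 ell01 kP fm mu0P ppi0 S0 q1d q2d
  q1Phi.
move=> q2PB eps /andP[eps0 eps1] T hT H G' eta pol delta /andP[delta0 delta1].
have [x0 _|X0] := pickP (@predT X); last first.
  have := q2d.2; rewrite big1; last by move=> x; have := X0 x.
  by move=> /esym/eqP; rewrite oner_eq0.
have ppol theta : is_policy (pol theta) := pi_theta_policy Phi mu0 ppi0 theta.
have tau_gt0 theta : 0 < tau (pol theta) := (fm _ (ppol theta)).1.
have L0 : 0 <= ln delta^-1 by rewrite ln_ge0// -invr1 lef_pV2 ?posrE// ltW.
have C10 := C1_ge0 Phi q1; have C20 := C2_ge0 P Phi q2.
have V10 theta : 0 <= V1 Phi mu0 theta by apply: sumr_ge0.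
have V20 theta : 0 <= V2 P Phi mu0 theta by apply: sumr_ge0.
have loss01 theta : 0 <= loss ell (mu_pol P (pol theta)) <= 1.
  by apply: loss_dist_bounds => //; exact: mu_pol_dist.
have H0 : 0 < H by rewrite invr_gt0.
have const2 theta th' := error_const_ge2 d (ltW S0) C10 C20 L0
  (ltW (tau_gt0 theta)) (ltW (tau_gt0 th')).
(* Without features every parameter gives the same policy. *)
have [d0|d_gt0] := posnP d.
  apply: Pr_samples_sure => //; first exact: ltW.
  move=> ws th theta _; rewrite meval_error_poly.
  have -> : th = theta by apply/rowP => -[i hi]; exfalso; rewrite d0 in hi.
  rewrite -addrA lerDl; apply: addr_ge0; apply: mulr_ge0.
  - exact: ltW.
  - exact: addr_ge0.
  - exact: ltW.
  - exact: le_trans (const2 _ _).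
have [e2|e2] := ltP (1 / 2) eps.
  apply: Pr_samples_sure => //; first exact: ltW.
  move=> ws th theta _; rewrite meval_error_poly.
  have /andP[_ l1] := loss01 th; have /andP[l0 _] := loss01 theta.
  have := ler_wpM2l (ltW eps0) (const2 theta th).
  have : 0 <= eps^-1 * (V1 Phi mu0 theta + V2 P Phi mu0 theta).
    by rewrite mulr_ge0 ?addr_ge0// ltW.
  lra.
have [[theta0 Tt0]|noT] := pselect (exists theta, Theta Phi mu0 S theta); last
  first.
  apply: Pr_samples_sure => //; first exact: ltW.
  by move=> ws th theta Tt; case: noT; exists theta.
have e40 : 0 < eps ^+ 4 by rewrite exprn_gt0.
have e4 : eps ^+ 4 <= 1 / 2 * eps ^+ 3.
  by rewrite exprS ler_wpM2r// exprn_ge0// ltW.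
have e3 : eps ^+ 3 <= 1 / 8.
  rewrite (_ : 1 / 8 = (1 / 2) ^+ 3 :> R); last by field.
  by rewrite ler_pXn2r// ?nnegrE ?ltW//; lra.
(* Here [eps^-4 >= 16], so rounding by less than 1 leaves more than a quarter of it. *)
have hT4 : (4 * eps ^+ 4)^-1 <= T%:R.
  have : 16 <= (eps ^+ 4)^-1.
    by rewrite -[leRHS]mul1r ler_pdivlMr//; lra.
  move: hT; rewrite ltr_distl => /andP[h _].
  rewrite invfM; lra.
have T0 : (0 < T)%N.
  by rewrite -(ltr0n R) (lt_le_trans _ hT4)// invr_gt0 mulr_gt0.
(* Bounds the mass defect of the average by [eps / 2], since [4 * eps ^+ 4 <= eps / 2]. *)
have TV : T%:R^-1 <= eps / 2.
  rewrite -(@invrK _ (eps / 2)) lef_pV2 ?posrE ?ltr0n ?invr_gt0 ?divr_gt0//.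
  apply: le_trans hT4; rewrite lef_pV2 ?posrE ?divr_gt0 ?mulr_gt0//.
  have : eps ^+ 3 * eps <= 1 / 8 * eps by rewrite ler_wpM2r// ltW.
  by rewrite -exprSr; lra.
have G0 : 0 < G'.
  by rewrite ltr_pwDl ?mulr_ge0 ?addr_ge0 ?(ltW H0)// sqrtr_gt0 ltr0n.
(* As [H >= 1], the loss part [C1] is at most [H * (C1 + C2)], hence the factor 2. *)
have g2G w s v : `|dotv (subgrad P ell Phi mu0 q1 q2 H w s) v| <= 2 * G' *
  norm2 v.
  have := dotv_subgrad_le P mu0 ell01 q1d q2d q1Phi (ltW H0) w s v.
  move=> /le_trans; apply; rewrite ler_wpM2r ?norm2_ge0//.
  have H1 : 1 <= H by rewrite -invr1 lef_pV2 ?posrE// ltW.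
  have := ler_wpM2r (addr_ge0 C10 C20) H1; have := sqrtr_ge0 (d%:R : R).
  by rewrite /G'; lra.
apply: (excess_high_probability mu0P q1d q2d q1Phi q2PB S0 (ltW H0) G0 T0 g2G
  Tt0 delta0).
move=> ws hws th theta Tt; rewrite meval_error_poly.
have /andP[_ l1] := loss01 th; have /andP[l0 l1'] := loss01 theta.
set V := V1 _ _ _ + V2 _ _ _ _; set c := error_const _ _ _ _ _ _ _.
have V_ge0 : 0 <= V by rewrite addr_ge0.
(* If V >= eps the penalty alone exceeds the maximal loss 1. *)
have [Ve|Ve] := leP eps V.
  have : 1 <= eps^-1 * V by rewrite mulrC ler_pdivlMr// mul1r.
  have : 0 <= eps * c by rewrite mulr_ge0 ?(ltW eps0)// (le_trans _ (const2
    theta th)).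
  lra.
have mass_th : `|\sum_z lin_mu Phi mu0 th z - 1| <= eps / 2.
  by apply: le_trans TV; exact: (mass_theta_hat _ _ _ _ _ mu0P S0 _ Tt).
(* The comparator satisfies the mass constraint exactly, so [r = 0] for it. *)
have mass_theta : `|\sum_z lin_mu Phi mu0 theta z - 1| <= 0.
  rewrite /lin_mu big_split /= -(dotv_suml _ _ Phi) dotvC Tt.1.
  by rewrite addrC subrK subrr normr0.
have close_th := mu_theta_close ppi0 kP fm mass_th _.
have close_theta := mu_theta_close ppi0 kP fm mass_theta ltr01.
apply: (@combine_bounds _ eps _ _ (loss ell (lin_mu Phi mu0 theta))
  (loss ell (lin_mu Phi mu0 th)) _ (V1 Phi mu0 th + V2 P Phi mu0 th)) => //.
- by rewrite eps0.
- exact: ltW.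
- by rewrite addr_ge0.
- by rewrite sgd_const_ge0// ltW.
- exact: ltW.
- exact: ltW.
- rewrite -lerBlDl (le_trans (loss_le_norm1 _ _ ell01))//.
  by apply: close_th; lra.
- have := hws theta Tt; rewrite /penalized.
  have : S * (G' / Num.sqrt T%:R)
      * (3 + 8 * (1 + 2 * d%:R + ln delta^-1) * (1 + d%:R))
      <= eps * sgd_const S d%:R (C1 Phi q1) (C2 P Phi q2) (ln delta^-1).
    by apply: sgd_rate; rewrite ?eps0 // ltW.
  by move=> h1 h2; rewrite -lerBlDl (le_trans h2).
- by rewrite (le_trans (loss_lower_bound _ _ _ ell01))// lerDl.
- rewrite -lerBlDl (le_trans (loss_le_norm1 _ _ ell01))//.
  have := close_theta; rewrite mulr0 addr0 -/V.
  by apply: le_trans; apply: ler_sum => z _; rewrite distrC.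
Qed.
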